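(* Let $\Phi=\gamma*f$, where $f$ is a bounded Borel function on $\mathbb{R}$, and put $\Psi(z,w)=\Phi(z+\bar w)$. Then $\Psi$ gives rise to a solution to the mass-one equation if and only if there is a Borel set $e\subset\mathbb{R}$ of positive measure such that $f=\chi_e$ almost everywhere.
   Context: $\gamma(z)=\frac{1}{\sqrt{2\pi}}e^{-z^2/2}$ for $z\in\mathbb{C}$, and $(\gamma*f)(z)=\int_{-\infty}^{+\infty}\gamma(z-t)f(t)\,dt$, $z\in\mathbb{C}$. $\chi_e$ is the indicator function of $e$. $dA(z)=d^2z/\pi$ is Lebesgue measure divided by $\pi$. $G(z,w)=e^{z\bar w-|z|^2/2-|w|^2/2}$ is the Ginibre kernel. $\Psi$ gives rise to a solution to the mass-one equation if, for $K=G\Psi$, one has $K(z,z)=\Psi(z,z)>0$ for all $z\in\mathbb{C}$ and the Berezin kernel $B(z,w)=|K(z,w)|^2/K(z,z)$ satisfies $\int_{\mathbb{C}}B(z,w)\,dA(w)=1$ for all $z\in\mathbb{C}$, i.e. $$\int_{\mathbb{C}}e^{-|z-w|^2}|\Psi(z,w)|^2\,dA(w)=\Psi(z,z),\qquad z\in\mathbb{C}.$$ *)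

(* Defs.v *)
From HB Require Import structures.
From mathcomp Require Import all_boot all_order all_algebra.
From mathcomp Require Import all_classical all_reals all_analysis.
From mathcomp Require Import complex.
Set Implicit Arguments.
Unset Strict Implicit.
Unset Printing Implicit Defensive.
Import Order.TTheory GRing.Theory Num.Theory.
Local Open Scope classical_set_scope.
Local Open Scope ring_scope.

Section MassOne.
Context {R : realType}.
Local Notation C := R[i]%C.

(* The complex exponential, which the libraries lack: e^z = e^x (cos y + i sin y). *)
Definition cexp (z : C) : C :=
  (expR (complex.Re z))%:C%C * (cos (complex.Im z) +i* sin (complex.Im z))%C.

Definition gamma (z : C) : C :=
  ((Num.sqrt (2 * pi))^-1)%:C%C * cexp (- (z ^+ 2) / 2).

(* Lebesgue integral over the line of a complex-valued function. *)
Definition cintegral (F : R -> C) : C :=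
  ((\int[@lebesgue_measure R]_t complex.Re (F t)) +i*
   (\int[@lebesgue_measure R]_t complex.Im (F t)))%C.

Definition gamma_conv (f : R -> C) (z : C) : C :=
  cintegral (fun t => gamma (z - t%:C%C) * f t).

Lemma invpi_ge0 : 0 <= (pi : R)^-1.
Proof. by rewrite invr_ge0 pi_ge0. Qed.

(* The plane is identified with R * R by (u, v) |-> u + i v. *)
Definition dA : set (measurableTypeR R * measurableTypeR R) -> \bar R :=
  mscale (NngNum invpi_ge0)
    (@lebesgue_measure R \x @lebesgue_measure R)%E.

HB.instance Definition _ := Measure.on dA.

Definition to_complex (p : R * R) : C := (p.1 +i* p.2)%C.

(* [`|z|] is the modulus of z as an element of R[i]. *)
Definition ginibre (z w : C) : C :=
  cexp (z * conjc w - `|z| ^+ 2 / 2 - `|w| ^+ 2 / 2).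

Definition kernel_of (Psi : C -> C -> C) (z w : C) : C :=
  ginibre z w * Psi z w.

Definition berezin (K : C -> C -> C) (z w : C) : C :=
  `|K z w| ^+ 2 / K z z.

(* [0 < x] in R[i] means that x is real and positive.  Hence the values of the
   Berezin kernel are nonnegative reals, and taking the real part below only
   changes their type. *)
Definition mass_one_solution (Psi : C -> C -> C) : Prop :=
  let K := kernel_of Psi in
  (forall z : C, K z z = Psi z z /\ 0 < Psi z z) /\
  (forall z : C,
     (\int[dA]_p (complex.Re (berezin K z (to_complex p)))%:E = 1)%E).

(* Borel measurability of a complex-valued function, read componentwise: the
   Borel sigma-algebra of C = R * R is the product one. *)
Definition bounded_borel (f : R -> C) : Prop :=
  [/\ measurable_fun setT (fun t => complex.Re (f t)),
      measurable_fun setT (fun t => complex.Im (f t))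
    & exists M : R, forall t, `|f t| <= M%:C%C].

End MassOne.

(* Main.v *)
Require Import Defs.
From HB Require Import structures.
From mathcomp Require Import all_boot all_order all_algebra.
From mathcomp Require Import all_classical all_reals all_analysis.
From mathcomp Require Import complex.
From mathcomp Require Import measurable_realfun ring lra.
Import Order.TTheory GRing.Theory Num.Theory.
Import numFieldNormedType.Exports.
Local Open Scope classical_set_scope.
Local Open Scope ring_scope.

(** Write z = x + i y, w = u + i v, a = x + u and b = y - v.  Because
    gamma (a + i b - t) is the product of the real Gaussian gamma (a - t),
    of the phase e^{i b (t - a)} and of e^{b^2 / 2}, the number Phi (a + i b)
    is, up to a phase, e^{b^2 / 2} times the Fourier transform, at the frequency
    b, of the windowed function t |-> gamma (a - t) f (t).  The Ginibre kernel satisfies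
    |G (z, w)|^2 = e^{- (x - u)^2 - b^2}, and its decay in b cancels the growth
    e^{b^2} of |Phi|^2.  Integrating first over v, Plancherel's formula
    produces the integral of gamma (a - t)^2 |f (t)|^2 over t; integrating then
    over u is a Gaussian integral.  The outcome, [integral_windowed_energy], is

      int e^{- |z - w|^2} |Psi (z, w)|^2 dA (w) = (gamma * |f|^2) (2 x).

    Since Psi (z, z) = (gamma * f) (2 x), the mass-one equation says exactly
    that gamma * |f|^2 = gamma * f > 0 on the real line
    ([mass_one_solutionE]).  If f is an indicator function then |f|^2 = f and
    the equation holds.  Conversely Gaussian convolution is injective on
    bounded functions ([gaussian_convolution_injective]), so |f|^2 = f almost
    everywhere, which leaves only the values 0 and 1.

    Plancherel's formula ([plancherel]) is proved for bounded integrable real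
    functions p.  The squared modulus of the Fourier transform of p is the
    cosine transform of the autocorrelation C of p.  Against the weight
    e^{- eps |b|} the cosine transform turns into integration of C against the
    Poisson kernel, and rescaling the variable by eps gives
    int C (eps r) 2 / (1 + r^2) dr, which tends to 2 pi C (0) as eps tends
    to 0 because C is continuous at 0; C (0) is the integral of p^2.
    Continuity of C at 0 comes from the continuity of translations in L^1.

    Injectivity is also deduced from Plancherel's formula.  After completing
    the square, gamma * h = 0 on the line says that the two-sided Laplace
    transform of k (t) = e^{- t^2 / 2} h (t) vanishes.  Differentiating under
    the integral sign kills all the moments of k, expanding cos and sin in
    power series kills its Fourier transform, and Plancherel's formula then
    kills k. *)

Set Implicit Arguments.
Unset Strict Implicit.
Unset Printing Implicit Defensive.

(** * Affine changes of variables *)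

Section affine.
Context {R : realType}.
Notation mu := (@lebesgue_measure R).
Implicit Types a b : R.

Definition affine a b (x : measurableTypeR R) : measurableTypeR R := a * x + b.

Lemma measurable_affine a b : measurable_fun setT (affine a b).
Proof. by apply: measurable_funD => //; apply: measurable_funM. Qed.

(** Lebesgue measure transported by the affine map and rescaled by [`|a|]; it
    agrees with Lebesgue measure on half-open intervals, hence everywhere. *)
Definition affine_image a b : {measure set (measurableTypeR R) -> \bar R} :=
  mscale (NngNum (normr_ge0 a))
    (measure_function_pushforward__canonical__measure_function_Measure
       mu (measurable_affine a b)).

Lemma lebesgue_measure_affine a b (A : set (measurableTypeR R)) :
  a != 0 -> measurable A ->
  mu A = affine_image a b A.
Proof.
move=> a0 mA; apply: lebesgue_measure_unique mA => X [[c d] _ <-] /=.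
rewrite -[RHS]/(`|a|%:E * mu (affine a b @^-1` `]c, d]))%E /affine.
have [aneg|apos] := ltP a 0.
  rewrite (_ : _ @^-1` _ = `[(d - b) / a, (c - b) / a[%classic); last first.
    apply/seteqP; split=> x /=; rewrite !in_itv/= ler_ndivrMr// ltr_ndivlMr//;
      rewrite andbC => /andP[h1 h2]; apply/andP; split; lra.
  rewrite !lebesgue_measure_itv/= !lte_fin.
  rewrite ltr_nM2r ?invr_lt0// ltrD2r.
  case: ifP; rewrite ?mule0// => cd.
  by rewrite -!EFinB -EFinM; congr EFin; rewrite ltr0_norm//; field.
have {}apos : 0 < a by rewrite lt_def a0.
rewrite (_ : _ @^-1` _ = `](c - b) / a, (d - b) / a]%classic); last first.
  apply/seteqP; split=> x /=; rewrite !in_itv/= ler_pdivlMr// ltr_pdivrMr//;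
    move=> /andP[h1 h2]; apply/andP; split; lra.
rewrite !lebesgue_measure_itv/= !lte_fin.
rewrite ltr_pM2r ?invr_gt0// ltrD2r.
case: ifP; rewrite ?mule0// => cd.
by rewrite -!EFinB -EFinM; congr EFin; rewrite gtr0_norm//; field.
Qed.

Lemma ge0_integral_affine a b (G : R -> \bar R) : a != 0 ->
  measurable_fun setT G -> (forall x, 0 <= G x)%E ->
  (\int[mu]_x G x = `|a|%:E * \int[mu]_x G (a * x + b)%R)%E.
Proof.
move=> a0 mG G0.
rewrite (@eq_measure_integral _ _ _ _ (affine_image a b))/=; last first.
  by move=> A mA _; exact: lebesgue_measure_affine.
rewrite ge0_integral_mscale//= ge0_integral_pushforward//.
exact: measurable_affine.
Qed.

Lemma integrable_affine a b (G : R -> \bar R) : a != 0 ->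
  mu.-integrable setT G -> mu.-integrable setT (fun x => G (a * x + b)).
Proof.
move=> a0 /integrableP[mG iG]; apply/integrableP; split.
  exact: (measurableT_comp mG (measurable_affine a b)).
have := iG; rewrite (@ge0_integral_affine a b)//; last exact: measurableT_comp.
move=> h; rewrite ltNge leye_eq; apply/negP => /eqP h'; move: h.
by rewrite h' gt0_muley// lte_fin normr_gt0.
Qed.

Lemma integral_affine a b (G : R -> \bar R) : a != 0 ->
  mu.-integrable setT G ->
  (\int[mu]_x G x = `|a|%:E * \int[mu]_x G (a * x + b)%R)%E.
Proof.
move=> a0 iG; have iG' := integrable_affine b a0 iG.
have [mG _] := integrableP _ _ _ iG.
rewrite integralE [in RHS]integralE.
rewrite (@ge0_integral_affine a b (G^\+)%E)//; last exact: measurable_funepos.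
rewrite (@ge0_integral_affine a b (G^\-)%E)//; last exact: measurable_funeneg.
rewrite [RHS]muleBr//; last exact: integrable_add_def iG'.
by congr (_ * _ + oppe (_ * _))%E; apply: eq_integral => x _;
  rewrite ?funeposE ?funenegE.
Qed.

Lemma Rintegral_affine a b (G : R -> R) : a != 0 ->
  mu.-integrable setT (EFin \o G) ->
  \int[mu]_x G x = `|a| * \int[mu]_x G (a * x + b).
Proof.
move=> a0 iG; rewrite /Rintegral (@integral_affine a b (EFin \o G))//.
by rewrite fineM// integrable_fin_num//; exact: integrable_affine.
Qed.

End affine.

(** * Measurability, integrability and Fubini for real-valued functions *)

Section measurability.
Context d (T : measurableType d) {R : realType}.
Implicit Types f g : T -> R.

Lemma measurable_fun_comp_real (p : R -> R) f : measurable_fun setT p ->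
  measurable_fun setT f -> measurable_fun setT (fun x => p (f x)).
Proof. by move=> mp mf; exact: measurableT_comp. Qed.

Lemma measurable_fun_EFin f : measurable_fun setT f ->
  measurable_fun setT (fun x => (f x)%:E).
Proof. by move=> mf; apply/measurable_EFinP. Qed.

Lemma measurable_fun_expR f : measurable_fun setT f ->
  measurable_fun setT (fun x => expR (f x)).
Proof. by move=> mf; apply: measurable_fun_comp_real. Qed.

Lemma measurable_fun_normr f : measurable_fun setT f ->
  measurable_fun setT (fun x => `|f x|).
Proof. by move=> mf; apply: (@measurable_fun_comp_real (@Num.norm _ R)). Qed.

Lemma measurable_fun_cos f : measurable_fun setT f ->
  measurable_fun setT (fun x => cos (f x)).
Proof.
move=> mf; apply: measurable_fun_comp_real => //; apply: continuous_measurable_fun.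
exact: continuous_cos.
Qed.

Lemma measurable_fun_sin f : measurable_fun setT f ->
  measurable_fun setT (fun x => sin (f x)).
Proof.
move=> mf; apply: measurable_fun_comp_real => //; apply: continuous_measurable_fun.
exact: continuous_sin.
Qed.

End measurability.

(** Reduces measurability of an expression in real variables to that of the
    functions occurring in it.  The shapes are matched syntactically, because
    unification up to conversion would unfold those functions. *)
Ltac mfun := repeat match goal with
  | |- measurable_fun _ (fun x => (@?f x)%:E) => apply: measurable_fun_EFin
  | |- measurable_fun _ (fun x => `|@?f x|) => apply: measurable_fun_normr
  | |- measurable_fun _ (fun x => expR (@?f x)) => apply: measurable_fun_expR
  | |- measurable_fun _ (fun x => cos (@?f x)) => apply: measurable_fun_cos
  | |- measurable_fun _ (fun x => sin (@?f x)) => apply: measurable_fun_sin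
  | |- measurable_fun _ (fun x => @?f x ^+ _) => apply: measurable_funX
  | |- measurable_fun _ (fun x => @?f x * @?g x) => apply: measurable_funM
  | |- measurable_fun _ (fun x => - @?f x) => apply: measurable_funN
  | |- measurable_fun _ (fun x => @?f x + @?g x) => apply: measurable_funD
  | H : measurable_fun _ ?p |- measurable_fun _ ?p => exact: H
  | H : measurable_fun _ ?p |- measurable_fun _ (fun t => ?p (@?g t)) =>
      apply: (measurable_fun_comp_real H)
  | |- _ => exact: measurable_fst
  | |- _ => exact: measurable_snd
  | |- _ => done
  end.

Section real_integrable.
Context d (T : measurableType d) {R : realType} (mu : {measure set T -> \bar R}).
Implicit Types f g : T -> R.

Lemma integrable_realZl k f : mu.-integrable setT (EFin \o f) ->
  mu.-integrable setT (EFin \o (fun t => k * f t)).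
Proof. exact: (@integrableZl _ _ _ mu setT measurableT k (EFin \o f)). Qed.

Lemma integrable_realZr k f : mu.-integrable setT (EFin \o f) ->
  mu.-integrable setT (EFin \o (fun t => f t * k)).
Proof. exact: (@integrableZr _ _ _ mu setT measurableT k (EFin \o f)). Qed.

Lemma integrable_realD f g : mu.-integrable setT (EFin \o f) ->
  mu.-integrable setT (EFin \o g) ->
  mu.-integrable setT (EFin \o (fun t => f t + g t)).
Proof. exact: (@integrableD _ _ _ mu setT measurableT (EFin \o f)). Qed.

Lemma integrable_realB f g : mu.-integrable setT (EFin \o f) ->
  mu.-integrable setT (EFin \o g) ->
  mu.-integrable setT (EFin \o (fun t => f t - g t)).
Proof. exact: (@integrableB _ _ _ mu setT measurableT (EFin \o f)). Qed.

End real_integrable.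

Section real_ge0_integral.
Context d (T : measurableType d) {R : realType} (m : {measure set T -> \bar R}).
Implicit Types f g : T -> R.

Lemma ge0_integral_realD f g : measurable_fun setT f -> measurable_fun setT g ->
  (forall x, 0 <= f x) -> (forall x, 0 <= g x) ->
  (\int[m]_x (f x)%:E + \int[m]_x (g x)%:E = \int[m]_x (f x + g x)%:E)%E.
Proof.
move=> mf mg f0 g0; rewrite -ge0_integralD//.
- by move=> x _; rewrite lee_fin.
- exact/measurable_EFinP.
- by move=> x _; rewrite lee_fin.
- exact/measurable_EFinP.
Qed.

Lemma ge0_integral_realZl (k : R) f : measurable_fun setT f ->
  (forall x, 0 <= f x) -> 0 <= k ->
  (k%:E * \int[m]_x (f x)%:E = \int[m]_x (k * f x)%:E)%E.
Proof.
move=> mf f0 k0; rewrite -ge0_integralZl//.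
- exact/measurable_EFinP.
- by move=> x _; rewrite lee_fin.
Qed.

End real_ge0_integral.

Section real_fubini.
Context {R : realType} d1 d2 (T1 : measurableType d1) (T2 : measurableType d2).
Variables (m1 : {sigma_finite_measure set T1 -> \bar R})
          (m2 : {sigma_finite_measure set T2 -> \bar R}).
Implicit Types H : T1 * T2 -> R.

(** By definition the integral of a real function is the difference of the
    integrals of two nonnegative ones, and each of these is a measurable
    function of the parameter by Tonelli's theorem. *)
Lemma measurable_fun_Rintegral H : measurable_fun setT H ->
  measurable_fun setT (fun x => \int[m2]_y H (x, y)).
Proof.
move=> mH; have mEH : measurable_fun setT (EFin \o H) by apply/measurable_EFinP.
apply: (measurableT_comp (@fine_measurable R setT measurableT)).
rewrite [X in measurable_fun _ X](_ : _ = (fun x =>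
    \int[m2]_y (EFin \o H)^\+%E (x, y) -
    \int[m2]_y (EFin \o H)^\-%E (x, y)))%E; last first.
  by apply/funext => x; rewrite integralE; congr (_ + oppe _)%E;
    apply: eq_integral => y _; rewrite ?funeposE ?funenegE.
apply: emeasurable_funB.
  apply: measurable_fun_fubini_tonelli_F => //; first exact: measurable_funepos.
apply: measurable_fun_fubini_tonelli_F => //; first exact: measurable_funeneg.
Qed.

(** An integrable function is finite almost everywhere, so cutting its
    infinite values does not change the integral. *)
Lemma Rintegral_integrableE (F : T1 -> \bar R) : m1.-integrable setT F ->
  \int[m1]_x fine (F x) = fine (\int[m1]_x F x)%E.
Proof.
move=> iF; rewrite /Rintegral; congr fine; have mF := measurable_int _ iF.
apply: ae_eq_integral => //.
  apply/measurable_EFinP.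
  exact: (measurableT_comp (@fine_measurable R setT measurableT)).
by apply: filterS (integrable_ae measurableT iF) => x /(_ I) Fx _; rewrite fineK.
Qed.

Lemma integrable_fine (F : T1 -> \bar R) : m1.-integrable setT F ->
  m1.-integrable setT (EFin \o (fun x => fine (F x))).
Proof.
move=> iF; have mF := measurable_int _ iF.
apply: (le_integrable _ _ _ iF) => //.
  apply/measurable_EFinP.
  exact: (measurableT_comp (@fine_measurable R setT measurableT)).
by move=> x _ /=; case: (F x) => [r| |] //=; rewrite normr0 leey.
Qed.

End real_fubini.

Section fubini_swap.
Context {R : realType} d1 d2 (T1 : measurableType d1) (T2 : measurableType d2).
Variables (m1 : {sigma_finite_measure set T1 -> \bar R})
          (m2 : {sigma_finite_measure set T2 -> \bar R}).
Implicit Types H : T1 * T2 -> R.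

Lemma integrable_fubini_G (F : T1 * T2 -> \bar R) :
  (m1 \x m2)%E.-integrable setT F ->
  m2.-integrable setT (fun y => \int[m1]_x F (x, y))%E.
Proof.
move=> iF; have mF := measurable_int _ iF.
have hF := (integrable21ltyP _ _ mF).1 iF.
apply/integrableP; split; first exact: (measurable_fubini_G iF).
apply: le_lt_trans hF; apply: ge0_le_integral => //.
- by apply: measurableT_comp => //; exact: (measurable_fubini_G iF).
- apply: (measurable_fun_fubini_tonelli_G (abse \o F)) => //.
  exact: measurableT_comp.
  by move=> z /=.
- move=> y _; apply: le_abse_integral => //.
  exact: (measurableT_comp mF (measurable_pair2 y)).
Qed.

Lemma Rintegral_Fubini H : (m1 \x m2)%E.-integrable setT (EFin \o H) ->
  \int[m1]_x \int[m2]_y H (x, y) = \int[m2]_y \int[m1]_x H (x, y).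
Proof.
move=> iH.
rewrite (@Rintegral_integrableE _ _ _ m1
  (fun x => \int[m2]_y (H (x, y))%:E)%E); last first.
  exact: (integrable_fubini_F iH).
rewrite (@Rintegral_integrableE _ _ _ m2
  (fun y => \int[m1]_x (H (x, y))%:E)%E); last first.
  exact: (integrable_fubini_G iH).
congr fine; exact: (Fubini iH).
Qed.

End fubini_swap.

(** * Continuity of translations and of the autocorrelation *)

Section L1.
Context {R : realType}.
Notation mu := (@lebesgue_measure R).
Implicit Types p h : R -> R.

Lemma integrable_le p q : measurable_fun setT p ->
  mu.-integrable setT (EFin \o q) -> (forall t, `|p t| <= q t) ->
  mu.-integrable setT (EFin \o p).
Proof.
move=> mp iq pq; apply: (le_integrable _ _ _ iq) => //.
  exact/measurable_EFinP.
move=> t _ /=; rewrite lee_fin; apply: le_trans (pq t) _; exact: ler_norm.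
Qed.

Lemma integrable_EFin_mfun p : mu.-integrable setT (EFin \o p) ->
  measurable_fun setT p.
Proof. by case/integrableP => /measurable_EFinP. Qed.

Lemma ereal_cvg0_near_lt (u : nat -> \bar R) (e : R) : 0 < e ->
  u n @[n --> \oo] --> 0%E -> \forall n \near \oo, (u n < e%:E)%E.
Proof.
by move=> e0 /(_ [set x | (x < e%:E)%E]); apply; apply: open_ereal_lt';
  rewrite lte_fin.
Qed.

(** The case of everywhere convergence and an everywhere bound, which spares
    the null sets of the general theorem. *)
Lemma real_dominated_convergence (f_ : nat -> R -> R) (f g : R -> R) :
  (forall n, measurable_fun setT (f_ n)) ->
  (forall t, f_ ^~ t @ \oo --> f t) ->
  mu.-integrable setT (EFin \o g) ->
  (forall n t, `|f_ n t| <= g t) ->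
  [/\ mu.-integrable setT (EFin \o f),
     (\int[mu]_t (`|f_ n t - f t|)%:E @[n --> \oo] --> 0)%E &
     \int[mu]_t f_ n t @[n --> \oo] --> \int[mu]_t f t].
Proof.
move=> mf_ cf ig fg.
have mf : measurable_fun setT f.
  by apply: (measurable_fun_cvg mf_) => t _; exact: cf.
have [|||||i0 i1 i2] := @dominated_convergence _ _ R mu setT measurableT
  (fun n => EFin \o f_ n) (EFin \o f) (EFin \o g).
- by move=> n; apply/measurable_EFinP; exact: mf_.
- exact/measurable_EFinP.
- by apply: aeW => t _; apply: cvg_EFin; [exact: nearW|exact: cf].
- exact: ig.
- by apply: aeW => t n _ /=; rewrite lee_fin.
split => //; apply: fine_cvg; rewrite fineK; last exact: integrable_fin_num.
exact: i2.
Qed.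

(** A tent that makes the approximants below continuous and compactly
    supported at once, so that their translates converge at every point. *)
Definition cutoff (N t : R) : R := Num.max 0 (Num.min 1 (N + 1 - `|t|)).

Lemma cutoff_ge0 N t : 0 <= cutoff N t.
Proof. by rewrite /cutoff le_max lexx. Qed.

Lemma cutoff_le1 N t : cutoff N t <= 1.
Proof. by rewrite /cutoff ge_max ler01 ge_min lexx. Qed.

Lemma cutoff_eq1 N t : `|t| <= N -> cutoff N t = 1.
Proof.
move=> tN; rewrite /cutoff min_l; last by lra.
by rewrite max_r.
Qed.

Lemma cutoff_eq0 N t : N + 1 < `|t| -> cutoff N t = 0.
Proof.
move=> tN; rewrite /cutoff max_l// ge_min; apply/orP; right; lra.
Qed.

Lemma continuous_cutoff N : continuous (cutoff N).
Proof.
move=> t; rewrite /cutoff.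
apply: (@continuous_max _ _ (cst 0) (fun t => Num.min 1 (N + 1 - `|t|))).
  exact: cvg_cst.
apply: (@continuous_min _ _ (cst 1) (fun t => (N + 1 - `|t|))).
  exact: cvg_cst.
apply: (@cvgB _ R^o); first exact: cvg_cst.
exact: norm_continuous.
Qed.

(** Cut [p] off to a bounded interval, where continuous functions are dense in
    L^1, and multiply the approximant by the same cutoff: since the cutoff is
    at most 1, this does not increase the error. *)
Lemma continuous_compact_dense_L1 p (e : R) : 0 < e ->
  mu.-integrable setT (EFin \o p) ->
  exists h, [/\ continuous h,
    exists N K, 0 <= K /\ forall t, `|h t| <= K * \1_`[- N, N] t
    & (\int[mu]_t `|p t - h t|%:E < e%:E)%E].
Proof.
move=> e0 ip; have mp := integrable_EFin_mfun ip.
have [N HN] : exists N : nat,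
    (\int[mu]_t `|p t * cutoff N%:R t - p t|%:E < (e / 2)%:E)%E.
  have [||||_ + _] := @real_dominated_convergence
    (fun n t => p t * cutoff n%:R t) p (fun t => `|p t|).
  - move=> n; apply: measurable_funM => //.
    by apply: continuous_measurable_fun; exact: continuous_cutoff.
  - move=> t; apply/cvgrPdist_le => d d0; near=> n.
    rewrite cutoff_eq1 ?mulr1 ?subrr ?normr0 ?ltW//.
    by near: n; exact: nbhs_infty_gtr.
  - exact: integrable_norm.
  - move=> n t; rewrite normrM (ger0_norm (cutoff_ge0 _ _)).
    by rewrite ler_piMr// cutoff_le1.
  have e20 : 0 < e / 2 by rewrite divr_gt0.
  by move=> /(ereal_cvg0_near_lt e20)[N _ /(_ N (leqnn N))]; exists N.
pose E : set R := `[- (N%:R + 1), N%:R + 1]%classic.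
have mE : measurable (E : set (measurableTypeR R)) by exact: measurable_itv.
have muE : (mu E < +oo)%E.
  by rewrite /E lebesgue_measure_itv/=; case: ifP => _; rewrite ltry.
have [g_ [cg ig]] := @approximation_continuous_integrable R E p mE muE
  (integrableS measurableT mE (@subsetT _ _) ip).
move=> /(ereal_cvg0_near_lt (divr_gt0 e0 (ltr0n R 2)))[n _ /(_ n (leqnn n))].
move: (g_ n) (cg n) (ig n) => g {}cg {}ig Hg.
have mg := continuous_measurable_fun cg.
have E0 t : t \notin E -> cutoff N%:R t = 0.
  move=> tE; apply: cutoff_eq0; rewrite ltNge; apply: contra tE => tN.
  by rewrite inE /E/= in_itv/= -ler_norml.
exists (fun t => g t * cutoff N%:R t); split.
- move=> t; apply: (@cvgM _ R^o); first exact: cg.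
  exact: continuous_cutoff.
- exists (N%:R + 1).
  have NN : - (N%:R + 1) <= N%:R + 1 :> R.
    by rewrite (@le_trans _ _ 0)// ?oppr_le0 addr_ge0.
  have [|c _ Hc] := @EVT_max R (fun t => `|g t|) _ _ NN.
    apply: continuous_subspaceT => t; apply: continuous_comp; first exact: cg.
    exact: norm_continuous.
  exists `|g c|; split=> // t; rewrite indicE.
  have [tE|tE] := boolP (t \in E); last first.
    by rewrite E0// mulr0 normr0 mulr0.
  rewrite mulr1 normrM (ger0_norm (cutoff_ge0 _ _)).
  rewrite (le_trans _ (Hc t _))//; last by move: tE; rewrite inE.
  by rewrite ler_piMr// cutoff_le1.
- have mc : measurable_fun setT (cutoff N%:R : R -> R).
    by apply: continuous_measurable_fun; exact: continuous_cutoff.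
  apply: (@le_lt_trans _ _ (\int[mu]_t (`|p t * cutoff N%:R t - p t|%:E +
     (`|p t - g t| * \1_E t)%:E))%E).
    apply: ge0_le_integral => //=.
    + by mfun.
    + by apply: emeasurable_funD; mfun.
    + move=> t _; rewrite -EFinD lee_fin indicE.
      have [tE|tE] := boolP (t \in E); last first.
        by rewrite E0// !mulr0 subr0 sub0r normrN addr0.
      rewrite mulr1 -(normrN (p t * _ - _)) opprB.
      rewrite (_ : p t - g t * cutoff N%:R t = (p t - p t * cutoff N%:R t) +
        (p t - g t) * cutoff N%:R t); last by ring.
      rewrite (le_trans (ler_normD _ _))// lerD2l normrM (ger0_norm (cutoff_ge0 _ _)).
      by rewrite ler_piMr// cutoff_le1.
  rewrite ge0_integralD//=.
  + rewrite [e in X in (_ < X)%E](splitr e) EFinD lteD//.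
    apply: le_lt_trans Hg; rewrite [leRHS]integral_mkcond.
    apply: ge0_le_integral => //=.
    + by mfun.
    + apply/(measurable_restrictT _ mE); apply: measurable_funTS; mfun.
    + move=> t _; rewrite patchE indicE; case: ifP => _; last by rewrite mulr0.
      by rewrite mulr1.
  + by mfun.
  + by mfun.
Unshelve. all: by end_near. Qed.

Lemma normr_Rintegral_le (f : R -> R) : mu.-integrable setT (EFin \o f) ->
  (`|\int[mu]_t f t|%:E <= \int[mu]_t `|f t|%:E)%E.
Proof.
move=> iF; rewrite EFin_normr_Rintegral//.
apply: le_abse_integral => //; exact: (measurable_int mu).
Qed.

(** Translation preserves the L^1 distance to a continuous compactly supported
    approximant [h], and for [h] the claim is dominated convergence. *)
Lemma L1_translation_near p (r : nat -> R) (e : R) : 0 < e ->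
  mu.-integrable setT (EFin \o p) -> r n @[n --> \oo] --> 0 ->
  \forall n \near \oo, (\int[mu]_t (`|p (t + r n) - p t|)%:E < e%:E)%E.
Proof.
move=> e0 ip r0; have mp := integrable_EFin_mfun ip.
have e3 : 0 < e / 3 by rewrite divr_gt0.
have [h [ch [N [K [K0 hNK]]] hp]] := continuous_compact_dense_L1 e3 ip.
have mh := continuous_measurable_fun ch.
have [B HB] : exists B, forall n, `|r n| <= B.
  have /cvg_seq_bounded/pinfty_ex_gt0[B _ HB] : cvgn (r : R^o ^nat).
    by apply/cvg_ex; exists 0.
  by exists B => n; exact: HB.
have : (\int[mu]_t (`|h (t + r n) - h t|)%:E @[n --> \oo] --> 0)%E.
  have [||||_ + _] := @real_dominated_convergence
    (fun n t => h (t + r n)) h (fun t => K * \1_`[- (N + B), N + B] t).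
  - by move=> n; mfun.
  - move=> t; apply: continuous_cvg; first exact: ch.
    rewrite -[X in _ --> X]addr0; apply: (@cvgD _ R^o) => //; exact: cvg_cst.
  - by apply: integrable_realZl; exact: integrable_indic_itv.
  - move=> n t; apply: le_trans (hNK _) _.
    rewrite ler_wpM2l// !indicE.
    have [tN|_] := boolP (t + r n \in _); last by case: (t \in _).
    have /andP[h1 h2] : - N <= t + r n <= N by move: tN; rewrite inE/= in_itv.
    have := HB n; rewrite ler_norml => /andP[h3 h4].
    by rewrite mem_set//= in_itv/=; apply/andP; split; lra.
  by [].
move=> /(ereal_cvg0_near_lt e3); apply: filterS => n hn.
apply: (@le_lt_trans _ _ (\int[mu]_t (`|p (t + r n) - h (t + r n)|%:E +
   (`|h (t + r n) - h t|%:E + `|p t - h t|%:E)))%E).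
  apply: ge0_le_integral => //=.
  - by mfun.
  - by apply: emeasurable_funD; [|apply: emeasurable_funD]; mfun.
  - move=> t _; rewrite -!EFinD lee_fin.
    rewrite -[X in `|X|](_ : (p (t + r n) - h (t + r n)) +
      ((h (t + r n) - h t) + (h t - p t)) = _); last by ring.
    rewrite (le_trans (ler_normD _ _))// lerD2l.
    by rewrite (le_trans (ler_normD _ _))// lerD2l distrC.
rewrite ge0_integralD//=; [|by mfun| |by apply: emeasurable_funD; mfun]; last first.
  by move=> t _; rewrite adde_ge0// lee_fin.
rewrite ge0_integralD//=; [|by mfun|by mfun].
rewrite (_ : e = e / 3 + (e / 3 + e / 3)); last by field.
rewrite !EFinD lteD//; last by rewrite lteD.
move: hp; rewrite (@ge0_integral_affine _ 1 (r n))//.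
  rewrite normr1 mul1e; apply: le_lt_trans; apply: ge0_le_integral => //=.
  - by mfun.
  - by mfun.
  - by move=> t _; rewrite mul1r.
by mfun.
Qed.

Definition autocorrelation p (r : R) : R := \int[mu]_t (p t * p (t + r)).

Lemma integrable_autocorrelation_fun p (M c : R) :
  mu.-integrable setT (EFin \o p) -> (forall t, `|p t| <= M) ->
  mu.-integrable setT (EFin \o (fun t : R => p t * p (t + c))).
Proof.
move=> ip pM; have mp := integrable_EFin_mfun ip.
have mpp : measurable_fun setT (fun t : R => p t * p (t + c)) by mfun.
apply: (@integrable_le _ (fun t => `|p t| * M)); first exact: mpp.
  by apply: integrable_realZr; exact: integrable_norm.
by move=> t; rewrite normrM ler_wpM2l.
Qed.

(** As [p] is bounded, the increments of the autocorrelation are bounded by the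
    L^1 distance between [p] and its translate. *)
Lemma autocorrelation_cvg0 p (M : R) (r : nat -> R) :
  mu.-integrable setT (EFin \o p) -> (forall t, `|p t| <= M) ->
  r n @[n --> \oo] --> 0 ->
  autocorrelation p (r n) @[n --> \oo] --> autocorrelation p 0.
Proof.
move=> ip pM r0; apply/cvgrPdist_lt => e e0.
have M1 : 0 < M + 1 by have := le_trans (normr_ge0 _) (pM 0); lra.
have mp := integrable_EFin_mfun ip.
have ipp c := integrable_autocorrelation_fun c ip pM.
apply: filterS (L1_translation_near (divr_gt0 e0 M1) ip r0) => n hn.
rewrite -lte_fin /autocorrelation -RintegralB//.
apply: le_lt_trans (normr_Rintegral_le _) _.
  exact: integrable_realB.
apply: (@le_lt_trans _ _ (\int[mu]_t ((M + 1)%:E * (`|p (t + r n) - p t|)%:E))%E).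
  apply: ge0_le_integral => //=.
  - by mfun.
  - by apply: (@emeasurable_funM _ _ _ _ (cst (M + 1)%:E)) => //; mfun.
  - move=> t _; rewrite -EFinM lee_fin addr0 -mulrBr distrC normrM distrC.
    by rewrite ler_wpM2r// (le_trans (pM _))// lerDl.
rewrite ge0_integralZl//=; [|by mfun|by rewrite lee_fin ltW].
rewrite -lte_pdivlMl//; move: hn; congr (_ < _)%E; rewrite -EFinM mulrC//.
Qed.

End L1.

(** * The Poisson kernel as the cosine transform of an exponential *)

Section pointwise_derivatives.
Context {R : realType}.
Implicit Types f g : R -> R.

Lemma is_derive_funM f g (x df dg : R) : is_derive x (1:R) f df ->
  is_derive x (1:R) g dg ->
  is_derive x (1:R) (fun x => f x * g x) (f x * dg + g x * df).
Proof. by move=> hf hg; exact: (@is_deriveM _ _ f g x 1 df dg). Qed.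

Lemma is_derive_funD f g (x df dg : R) : is_derive x (1:R) f df ->
  is_derive x (1:R) g dg -> is_derive x (1:R) (fun x => f x + g x) (df + dg).
Proof. by move=> hf hg; exact: (@is_deriveD _ _ _ f g x 1 df dg). Qed.

Lemma is_derive_funZ f (k x df : R) : is_derive x (1:R) f df ->
  is_derive x (1:R) (fun x => k * f x) (k * df).
Proof. by move=> hf; exact: (@is_deriveZ _ _ _ f k x 1 df). Qed.

Lemma is_derive_expR_lin (k x : R) :
  is_derive x (1:R) (fun x => expR (k * x)) (k * expR (k * x)).
Proof.
rewrite mulrC; apply: (@is_derive1_comp _ expR (fun x => k * x)).
by rewrite -[X in is_derive _ _ _ X]mulr1; apply: is_derive_funZ; exact: is_derive_id.
Qed.

Lemma is_derive_cos_lin (k x : R) :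
  is_derive x (1:R) (fun x => cos (k * x)) (k * - sin (k * x)).
Proof.
rewrite mulrC; apply: (@is_derive1_comp _ cos (fun x => k * x)).
by rewrite -[X in is_derive _ _ _ X]mulr1; apply: is_derive_funZ; exact: is_derive_id.
Qed.

Lemma is_derive_sin_lin (k x : R) :
  is_derive x (1:R) (fun x => sin (k * x)) (k * cos (k * x)).
Proof.
rewrite mulrC; apply: (@is_derive1_comp _ sin (fun x => k * x)).
by rewrite -[X in is_derive _ _ _ X]mulr1; apply: is_derive_funZ; exact: is_derive_id.
Qed.

End pointwise_derivatives.

Section laplace.
Context {R : realType}.
Notation mu := (@lebesgue_measure R).
Implicit Types eps b r : R.

(** Adding 1 to the cosine makes the integrand nonnegative, so that the
    fundamental theorem of calculus applies directly on a half-line; the extra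
    exponential is subtracted in [Rintegral_laplace_cos]. *)
Lemma integral0y_expR_1Dcos eps r : 0 < eps ->
  (\int[mu]_(b in `[0%R, +oo[) (expR (- eps * b) * (1 + cos (r * b)))%:E =
   (eps^-1 + eps / (eps ^+ 2 + r ^+ 2))%:E)%E.
Proof.
move=> e0; have er0 : 0 < eps ^+ 2 + r ^+ 2 by rewrite ltr_pwDl ?exprn_gt0 ?sqr_ge0.
pose D := (eps ^+ 2 + r ^+ 2)^-1.
(* F is the antiderivative of the integrand that vanishes at infinity. *)
pose F b : R := expR (- eps * b) *
  (- eps^-1 + D * (r * sin (r * b) + (- eps) * cos (r * b))).
have dF (b : R) : is_derive b (1:R) F (expR (- eps * b) * (1 + cos (r * b))).
  have := is_derive_funM (is_derive_expR_lin (- eps) b)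
   (is_derive_funD (is_derive_cst (- eps^-1) b (1:R))
     (is_derive_funZ D (is_derive_funD (is_derive_funZ r (is_derive_sin_lin r b))
        (is_derive_funZ (- eps) (is_derive_cos_lin r b))))).
  move=> h; apply: is_derive_eq h _; rewrite /D /cst.
  by field; apply/andP; split; rewrite gt_eqF.
have cf : continuous (fun b : R => expR (- eps * b) * (1 + cos (r * b))).
  move=> b; apply: differentiable_continuous; apply/derivable1_diffP.
  apply: (@ex_derive _ _ _ _ _ _ _ (is_derive_funM (is_derive_expR_lin (- eps) b)
   (is_derive_funD (is_derive_cst (1 : R) b (1:R)) (is_derive_cos_lin r b)))).
have Fy : F b @[b --> +oo] --> 0.
  apply/norm_cvg0P.
  pose K := eps^-1 + D * (`|r| + eps).
  apply: (@squeeze_cvgr _ _ _ _ (cst 0) (fun b => expR (- (eps * b)) * K)).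
  - apply: nearW => b; rewrite /= normr_ge0/= /F normrM mulNr ger0_norm ?expR_ge0//.
    rewrite ler_wpM2l ?expR_ge0// /K (le_trans (ler_normD _ _))//.
    have D0 : 0 < D by rewrite invr_gt0.
    rewrite normrN gtr0_norm ?invr_gt0// lerD2l normrM (gtr0_norm D0).
    rewrite ler_pM2l// (le_trans (ler_normD _ _))// !normrM normrN (gtr0_norm e0).
    apply: lerD; first by rewrite ler_piMr// ler_norml sin_geN1 sin_le1.
    by rewrite ler_piMr ?(ltW e0)// ler_norml cos_geN1 cos_le1.
  - exact: cvg_cst.
  - rewrite -[X in _ --> X](mul0r K); apply: (@cvgM _ R^o); last exact: cvg_cst.
    apply: (@cvg_comp _ _ _ (fun b => eps * b) (fun b => expR (- b)) +oo +oo).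
      by apply: gt0_cvgMry => //; exact: cvg_id.
    exact: cvgr_expR.
rewrite (@ge0_continuous_FTC2y R _ F 0 0)//.
- rewrite /F !mulr0 expR0 sin0 cos0 sub0e mulr0 add0r mulr1 mul1r.
  by rewrite -EFinN; congr EFin; rewrite /D; ring.
- exact: continuous_subspaceT.
- apply: cvg_at_right_filter; apply: differentiable_continuous.
  by apply/derivable1_diffP; apply: ex_derive.
- by move=> b _; rewrite derive1E; apply: derive_val.
Qed.

Definition laplace eps b : R := expR (- eps * `|b|).

Lemma laplace_ge0 eps b : 0 <= laplace eps b. Proof. exact: expR_ge0. Qed.

Lemma continuous_laplace eps : continuous (laplace eps).
Proof.
move=> b; apply: continuous_comp; last exact: continuous_expR.
apply: (@cvgM _ R^o); [exact: cvg_cst|exact: norm_continuous].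
Qed.

Lemma measurable_laplace eps : measurable_fun setT (laplace eps).
Proof. by rewrite /laplace; mfun. Qed.

Lemma integral_laplace_1Dcos eps r : 0 < eps ->
  (\int[mu]_b (laplace eps b * (1 + cos (r * b)))%:E =
   (2 / eps + 2 * eps / (eps ^+ 2 + r ^+ 2))%:E)%E.
Proof.
move=> e0; rewrite ge0_symfun_integralT.
- rewrite -set_itvcy; under eq_integral.
    move=> b; rewrite inE/= in_itv/= andbT => b0.
    rewrite /laplace ger0_norm//; over.
  by rewrite integral0y_expR_1Dcos// -EFinM; congr EFin; field; nra.
- by move=> b; rewrite mulr_ge0 ?laplace_ge0//; have := cos_geN1 (b * r); lra.
- move=> b; apply: (@cvgM _ R^o); first exact: continuous_laplace.
  apply: (@cvgD _ R^o); first exact: cvg_cst.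
  apply: (@continuous_comp _ _ _ (fun b => r * b) cos); last exact: continuous_cos.
  by apply: (@cvgM _ R^o); [exact: cvg_cst|exact: cvg_id].
- by move=> b /=; rewrite /laplace normrN mulrN cosN.
Qed.

(** The value at [r = 0] of the previous integral is twice this one. *)
Lemma integral_laplace eps : 0 < eps ->
  (\int[mu]_b (laplace eps b)%:E = (2 / eps)%:E)%E.
Proof.
move=> e0; have := integral_laplace_1Dcos 0 e0.
under eq_integral do rewrite mul0r cos0 mulrC EFinM.
rewrite ge0_integralZl//=; last 2 first.
- by apply/measurable_EFinP; exact: measurable_laplace.
- by move=> b _; rewrite lee_fin laplace_ge0.
have -> : 2 / eps + 2 * eps / (eps ^+ 2 + 0 ^+ 2) = (1 + 1) * (2 / eps) by field; lra.
rewrite EFinM => /(congr1 (fun x => (1 + 1)^-1%:E * x))%E.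
by rewrite !muleA -!EFinM mulVf ?mul1r ?mul1e.
Qed.

Lemma integrable_laplace eps : 0 < eps ->
  mu.-integrable setT (EFin \o laplace eps).
Proof.
move=> e0; apply/integrableP; split.
  by apply/measurable_EFinP; exact: measurable_laplace.
under eq_integral do rewrite /= ger0_norm ?laplace_ge0//.
by rewrite integral_laplace// ltry.
Qed.

Lemma Rintegral_laplace_cos eps r : 0 < eps ->
  \int[mu]_b (laplace eps b * cos (r * b)) = 2 * eps / (eps ^+ 2 + r ^+ 2).
Proof.
move=> e0; have il := integrable_laplace e0.
have ml := measurable_laplace eps.
have ic : mu.-integrable setT (EFin \o (fun b => laplace eps b * cos (r * b))).
  apply: (integrable_le _ il); first by mfun.
  move=> b; rewrite normrM (ger0_norm (laplace_ge0 _ _)) ler_piMr ?laplace_ge0//.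
  by rewrite ler_norml cos_geN1 cos_le1.
have := integral_laplace_1Dcos r e0 => /(congr1 fine)/=.
rewrite -/(Rintegral mu setT _).
under eq_Rintegral do rewrite mulrDr mulr1.
rewrite RintegralD// {1}/Rintegral integral_laplace//=.
by move/addrI.
Qed.

Lemma integral_2oneDsqr :
  (\int[mu]_x (2 / (1 + x ^+ 2))%:E = (2 * pi)%:E :> \bar R)%E.
Proof.
have h0 x : 0 <= 2 / (1 + x ^+ 2) :> R by rewrite divr_ge0// addr_ge0// sqr_ge0.
rewrite ge0_symfun_integralT//; last 2 first.
- move=> x; apply: (@cvgM _ R^o); first exact: cvg_cst.
  exact: continuous_oneDsqrV.
- by move=> x /=; rewrite sqrrN.
rewrite -set_itvcy; under eq_integral do rewrite EFinM.
rewrite ge0_integralZl//=; last 2 first.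
- apply/measurable_EFinP; apply: measurable_funTS; apply: continuous_measurable_fun.
  exact: continuous_oneDsqrV.
- by move=> x _; rewrite lee_fin invr_ge0 addr_ge0// sqr_ge0.
have := @integral0y_oneDsqr R; rewrite /oneDsqr => ->.
by rewrite -!EFinM; congr EFin; field.
Qed.

Lemma integrable_2oneDsqr :
  mu.-integrable setT (EFin \o (fun x => 2 / (1 + x ^+ 2))).
Proof.
have h0 x : 0 <= 2 / (1 + x ^+ 2) :> R by rewrite divr_ge0// addr_ge0// sqr_ge0.
apply/integrableP; split.
  apply/measurable_EFinP; apply: measurable_funM => //.
  by apply: continuous_measurable_fun; exact: continuous_oneDsqrV.
under eq_integral do rewrite /= ger0_norm//.
by rewrite integral_2oneDsqr ltry.
Qed.

End laplace.

(** * Plancherel's formula *)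

Section plancherel.
Context {R : realType}.
Notation mu := (@lebesgue_measure R).
Notation RR := (measurableTypeR R * measurableTypeR R)%type.
Implicit Types (p q : R -> R) (k : RR -> R).

Lemma integrable_prod_le1 p q k : mu.-integrable setT (EFin \o p) ->
  mu.-integrable setT (EFin \o q) -> measurable_fun setT k ->
  (forall z, `|k z| <= 1) ->
  (mu \x mu)%E.-integrable setT (EFin \o (fun z : RR => p z.1 * q z.2 * k z)).
Proof.
move=> ip iq mk k1.
have mp := integrable_EFin_mfun ip; have mq := integrable_EFin_mfun iq.
have mH : measurable_fun setT (fun z : RR => p z.1 * q z.2 * k z).
  by mfun.
apply/integrableP; split; first exact/measurable_EFinP.
apply: (@le_lt_trans _ _ (\int[mu \x mu]_z (`|p z.1| * `|q z.2|)%:E))%E.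
  apply: ge0_le_integral => //=.
  - by apply: measurable_fun_EFin; apply: measurable_fun_normr.
  - by mfun.
  - by move=> z _; rewrite lee_fin !normrM ler_piMr// mulr_ge0.
rewrite fubini_tonelli1//=; last by mfun.
rewrite /fubini_F; under eq_integral do under eq_integral do rewrite /= EFinM.
under eq_integral.
  move=> x _; rewrite ge0_integralZl//; last by mfun.
  over.
rewrite ge0_integralZr//; last by exact: integral_ge0.
  by apply: lte_mul_pinfty => //; [exact: integral_ge0|
    exact/integrable_fin_num/integrable_norm|case/integrableP: iq].
by mfun.
Qed.

(** The real and imaginary parts of the Fourier transform of [p] are taken with
    the origin of time at [a]; only the phase depends on [a]. *)
Definition fourier_cos a p b : R := \int[mu]_t (p t * cos (b * (t - a))).
Definition fourier_sin a p b : R := \int[mu]_t (p t * sin (b * (t - a))).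
Definition spectrum a p b : R := fourier_cos a p b ^+ 2 + fourier_sin a p b ^+ 2.

Lemma integrable_mul_le1 p (h : R -> R) : mu.-integrable setT (EFin \o p) ->
  measurable_fun setT h -> (forall t, `|h t| <= 1) ->
  mu.-integrable setT (EFin \o (fun t => p t * h t)).
Proof.
move=> ip mh h1; have mp := integrable_EFin_mfun ip.
apply: (@integrable_le _ _ (fun t => `|p t|)); first by mfun.
  exact: integrable_norm.
by move=> t; rewrite normrM ler_piMr.
Qed.

Lemma normr_cos_le1 (x : R) : `|cos x| <= 1.
Proof. by rewrite ler_norml cos_geN1 cos_le1. Qed.

Lemma normr_sin_le1 (x : R) : `|sin x| <= 1.
Proof. by rewrite ler_norml sin_geN1 sin_le1. Qed.

Lemma integrable_fourier_cos a p b : mu.-integrable setT (EFin \o p) ->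
  mu.-integrable setT (EFin \o (fun t => p t * cos (b * (t - a)))).
Proof.
move=> ip; apply: integrable_mul_le1 => //; first by mfun.
by move=> t; exact: normr_cos_le1.
Qed.

Lemma integrable_fourier_sin a p b : mu.-integrable setT (EFin \o p) ->
  mu.-integrable setT (EFin \o (fun t => p t * sin (b * (t - a)))).
Proof.
move=> ip; apply: integrable_mul_le1 => //; first by mfun.
by move=> t; exact: normr_sin_le1.
Qed.

Lemma integrable_prod_shift p (k : RR -> R) : mu.-integrable setT (EFin \o p) ->
  measurable_fun setT k -> (forall z, `|k z| <= 1) ->
  (mu \x mu)%E.-integrable setT
    (EFin \o (fun z : RR => p z.1 * p (z.1 + z.2) * k z)).
Proof.
move=> ip mk k1; have mp := integrable_EFin_mfun ip.
have mH : measurable_fun setT (fun z : RR => p z.1 * p (z.1 + z.2) * k z).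
  by mfun.
have mshift (x : R) : measurable_fun setT (fun y : R => p (x + y)).
  by apply: (measurable_fun_comp_real mp); apply: (@measurable_funD _ _ _ _ (cst x)).
apply/integrableP; split; first exact/measurable_EFinP.
apply: (@le_lt_trans _ _ (\int[mu \x mu]_z (`|p z.1| * `|p (z.1 + z.2)|)%:E))%E.
  apply: ge0_le_integral => //=.
  - by apply: measurable_fun_EFin; apply: measurable_fun_normr.
  - by mfun.
  - by move=> z _; rewrite lee_fin !normrM ler_piMr// mulr_ge0.
rewrite fubini_tonelli1//=; last by mfun.
rewrite /fubini_F; under eq_integral do under eq_integral do rewrite /= EFinM.
under eq_integral.
  move=> x _; rewrite ge0_integralZl//; last by have := mshift x => h; mfun.
  have -> : (\int[mu]_y `|p (x + y)|%:E = \int[mu]_y `|p y|%:E)%E.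
    rewrite [RHS](@ge0_integral_affine _ 1 x)//; last by mfun.
    rewrite normr1 mul1e; apply: eq_integral => y _.
    by rewrite mul1r addrC.
  over.
rewrite ge0_integralZr//; last by exact: integral_ge0.
  by apply: lte_mul_pinfty => //; [exact: integral_ge0|
    exact/integrable_fin_num/integrable_norm|case/integrableP: ip].
by mfun.
Qed.

(** Wiener-Khinchin: the product of two integrals of [p] becomes, after the
    shift [s = t + r] and Fubini's theorem, the cosine transform of the
    autocorrelation.  The phase [a] disappears since only [s - t] matters. *)
Lemma spectrumE a p M b : mu.-integrable setT (EFin \o p) ->
  (forall t, `|p t| <= M) ->
  spectrum a p b = \int[mu]_r (autocorrelation p r * cos (b * r)).
Proof.
move=> ip pM; have mp := integrable_EFin_mfun ip.
have iH : (mu \x mu)%E.-integrable setT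
    (EFin \o (fun z : RR => p z.1 * p (z.1 + z.2) * cos (b * z.2))).
  apply: (@integrable_prod_shift p (fun z => cos (b * z.2)) ip); first by mfun.
  by move=> z; exact: normr_cos_le1.
have /= FH := Rintegral_Fubini iH.
transitivity (\int[mu]_r \int[mu]_t (p t * p (t + r) * cos (b * r))); last first.
  apply: eq_Rintegral => r _; rewrite /autocorrelation RintegralZr//.
  exact: integrable_autocorrelation_fun pM.
rewrite -FH.
have ic := integrable_fourier_cos a b ip.
have isn := integrable_fourier_sin a b ip.
transitivity (\int[mu]_t (p t * cos (b * (t - a)) * fourier_cos a p b +
                          p t * sin (b * (t - a)) * fourier_sin a p b)).
  rewrite RintegralD; [|exact: measurableT|exact: integrable_realZr..].
  by rewrite !RintegralZr// !expr2.
apply: eq_Rintegral => t _.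
transitivity (p t * \int[mu]_r (p (t + r) * cos (b * r))); last first.
  rewrite -RintegralZl//; last first.
    apply: (@integrable_mul_le1 (fun r => p (t + r)) (fun r => cos (b * r))).
    - have := @integrable_affine R 1 t (EFin \o p) (oner_neq0 _) ip.
      by apply: eq_integrable => // r _ /=; rewrite mul1r addrC.
    - by mfun.
    - by move=> r; exact: normr_cos_le1.
  by apply: eq_Rintegral => r _; rewrite mulrA.
have -> : \int[mu]_r (p (t + r) * cos (b * r)) = \int[mu]_s (p s * cos (b * (s - t))).
  rewrite [RHS](@Rintegral_affine _ 1 t)//; last exact: integrable_fourier_cos.
  rewrite normr1 mul1r; apply: eq_Rintegral => r _.
  by rewrite mul1r addrK addrC.
rewrite /fourier_cos /fourier_sin.
transitivity (p t * (\int[mu]_s (cos (b * (t - a)) * (p s * cos (b * (s - a))) +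
     sin (b * (t - a)) * (p s * sin (b * (s - a)))))).
  rewrite RintegralD; [|exact: measurableT|exact: integrable_realZl..].
  by rewrite !RintegralZl//; ring.
congr (_ * _); apply: eq_Rintegral => s _.
rewrite (_ : b * (s - t) = b * (s - a) - b * (t - a)); last by ring.
by rewrite cosB; ring.
Qed.

Lemma normr_autocorrelation_le p M r : mu.-integrable setT (EFin \o p) ->
  (forall t, `|p t| <= M) -> `|autocorrelation p r| <= \int[mu]_t (`|p t| * M).
Proof.
move=> ip pM; apply: le_trans (le_normr_Rintegral _ _) _ => //.
  exact: integrable_autocorrelation_fun pM.
apply: le_Rintegral => //.
- by apply: integrable_norm; exact: integrable_autocorrelation_fun pM.
- by apply: integrable_realZr; exact: integrable_norm.
- by move=> t _; rewrite normrM ler_wpM2l.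
Qed.

Lemma integrable_autocorrelation p : mu.-integrable setT (EFin \o p) ->
  mu.-integrable setT (EFin \o autocorrelation p).
Proof.
move=> ip; have mp := integrable_EFin_mfun ip.
have iH : (mu \x mu)%E.-integrable setT
    (EFin \o (fun z : RR => p z.1 * p (z.1 + z.2))).
  have := @integrable_prod_shift p (cst 1) ip.
  under [X in EFin \o X]eq_fun do rewrite mulr1.
  by apply=> // z; rewrite normr1.
have := integrable_fubini_G iH.
exact: (@integrable_fine _ _ _ mu).
Qed.

Lemma measurable_spectrum a p : measurable_fun setT p ->
  measurable_fun setT (spectrum a p).
Proof.
move=> mp; rewrite /spectrum /fourier_cos /fourier_sin.
apply: measurable_funD; apply: measurable_funX.
  apply: (@measurable_fun_Rintegral _ _ _ _ _ mu
    (fun z : RR => p z.2 * cos (z.1 * (z.2 - a)))).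
  by mfun.
apply: (@measurable_fun_Rintegral _ _ _ _ _ mu
    (fun z : RR => p z.2 * sin (z.1 * (z.2 - a)))).
by mfun.
Qed.

Lemma spectrum_ge0 a p b : 0 <= spectrum a p b.
Proof. by rewrite addr_ge0 ?sqr_ge0. Qed.

(** Fubini's theorem replaces the weight by its cosine transform
    [2 eps / (eps^2 + r^2)], and the substitution of [eps r] for [r] moves the
    dependence on [eps] into the autocorrelation. *)
Lemma laplace_spectrum a p M eps : 0 < eps -> mu.-integrable setT (EFin \o p) ->
  (forall t, `|p t| <= M) ->
  (\int[mu]_b (laplace eps b * spectrum a p b)%:E =
   (\int[mu]_r (autocorrelation p (eps * r) * (2 / (1 + r ^+ 2))))%:E)%E.
Proof.
move=> e0 ip pM; have mp := integrable_EFin_mfun ip.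
have iC := integrable_autocorrelation ip; have mC := integrable_EFin_mfun iC.
have iL := integrable_laplace e0; have mL := @measurable_laplace _ eps.
have iH : (mu \x mu)%E.-integrable setT
    (EFin \o (fun z : RR => laplace eps z.1 * autocorrelation p z.2 * cos (z.1 * z.2))).
  apply: integrable_prod_le1 => //; first by mfun.
  by move=> z; exact: normr_cos_le1.
have iLS : mu.-integrable setT (EFin \o (fun b => laplace eps b * spectrum a p b)).
  have := integrable_fine (integrable_fubini_F iH).
  apply: eq_integrable => // b _; congr EFin; rewrite (spectrumE a b ip pM).
  rewrite -RintegralZl//; last first.
    by apply: integrable_mul_le1 => //; [mfun|move=> t; exact: normr_cos_le1].
  by apply: eq_Rintegral => r _; rewrite mulrA.
rewrite -[LHS]fineK; last exact: integrable_fin_num.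
congr EFin.
have /= FH := Rintegral_Fubini iH.
transitivity (\int[mu]_b \int[mu]_r (laplace eps b * autocorrelation p r * cos (b * r))).
  apply: eq_Rintegral => b _; rewrite (spectrumE a b ip pM).
  rewrite -RintegralZl//; last first.
    by apply: integrable_mul_le1 => //; [mfun|move=> t; exact: normr_cos_le1].
  by apply: eq_Rintegral => r _; rewrite mulrA.
rewrite FH.
have ker r : \int[mu]_b (laplace eps b * autocorrelation p r * cos (b * r)) =
    autocorrelation p r * (2 * eps / (eps ^+ 2 + r ^+ 2)).
  rewrite -Rintegral_laplace_cos// -RintegralZl//; last first.
    by apply: integrable_mul_le1 => //; [mfun|move=> t; exact: normr_cos_le1].
  by apply: eq_Rintegral => b _; rewrite mulrCA mulrA (mulrC r).
under eq_Rintegral do rewrite ker.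
rewrite (@Rintegral_affine _ eps 0); last 2 first.
- by rewrite gt_eqF.
- have := integrable_fine (integrable_fubini_G iH).
  by apply: eq_integrable => // r _; congr EFin; exact: ker.
rewrite gtr0_norm// -RintegralZl//; last first.
  have := integrable_affine 0 (lt0r_neq0 e0)
    (integrable_fine (integrable_fubini_G iH)).
  by apply: eq_integrable => // r _; congr EFin; exact: ker.
apply: eq_Rintegral => r _; rewrite addr0 mulrCA; congr (_ * _).
have r0 : 1 + r ^+ 2 != 0 by rewrite gt_eqF// ltr_pwDl// sqr_ge0.
have : eps ^+ 2 + (eps * r) ^+ 2 != 0.
  by rewrite exprMn -[X in X + _]mulr1 -mulrDr mulf_neq0// gt_eqF// exprn_gt0.
by move=> er; field; rewrite ?r0 ?er.
Qed.

(** Both sides are the limit of the same integrals as [eps] tends to 0: on the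
    frequency side by monotone convergence, on the time side by dominated
    convergence and continuity of the autocorrelation at 0. *)
Lemma plancherel a p M : mu.-integrable setT (EFin \o p) ->
  (forall t, `|p t| <= M) ->
  (\int[mu]_b (spectrum a p b)%:E = (2 * pi * \int[mu]_t (p t ^+ 2))%:E)%E.
Proof.
move=> ip pM; have mp := integrable_EFin_mfun ip.
have iC := integrable_autocorrelation ip; have mC := integrable_EFin_mfun iC.
have mS := measurable_spectrum a mp.
(* The weights e^{- eps |b|} increase to 1 along this sequence of eps. *)
pose e n : R := n.+1%:R^-1.
have e0 n : 0 < e n by rewrite invr_gt0.
have cvgL (b : R) : laplace (e n) b * spectrum a p b @[n --> \oo] --> spectrum a p b.
  rewrite -[X in _ --> X]mul1r; apply: cvgMr_tmp.
  rewrite -expR0; apply: continuous_cvg; first exact: continuous_expR.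
  rewrite -[X in _ --> X](mul0r `|b|); apply: cvgMr_tmp.
  by rewrite -oppr0; apply: (@cvgN _ R^o); exact: cvg_harmonic.
have cvg1 : (\int[mu]_b (laplace (e n) b * spectrum a p b)%:E @[n --> \oo] -->
     \int[mu]_b (spectrum a p b)%:E)%E.
  have -> : (\int[mu]_b (spectrum a p b)%:E =
     \int[mu]_b (limn (fun n => (laplace (e n) b * spectrum a p b)%:E)))%E.
    apply: eq_integral => b _; apply/esym/cvg_lim => //.
    by apply: cvg_EFin; [exact: nearW|exact: cvgL].
  apply: cvg_monotone_convergence => //.
  - by move=> n; have mL := @measurable_laplace R (e n); mfun.
  - by move=> n b _; rewrite lee_fin mulr_ge0 ?laplace_ge0 ?spectrum_ge0.
  - move=> b _ m n mn; rewrite lee_fin ler_wpM2r ?spectrum_ge0// ler_expR.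
    by rewrite !mulNr lerN2 ler_wpM2r// lef_pV2 ?posrE// ler_nat.
have cvg2 : (\int[mu]_b (laplace (e n) b * spectrum a p b)%:E @[n --> \oo] -->
     (2 * pi * \int[mu]_t (p t ^+ 2))%:E)%E.
  under eq_fun do rewrite (laplace_spectrum a (e0 _) ip pM).
  apply: cvg_EFin; first exact: nearW.
  pose B := \int[mu]_t (`|p t| * M).
  have [||||_ _] := @real_dominated_convergence R
    (fun n r => autocorrelation p (e n * r) * (2 / (1 + r ^+ 2)))
    (fun r => autocorrelation p 0 * (2 / (1 + r ^+ 2)))
    (fun r => B * (2 / (1 + r ^+ 2))).
  - move=> n; apply: measurable_funM; first by mfun.
    exact: integrable_EFin_mfun (@integrable_2oneDsqr R).
  - move=> r; apply: cvgMr_tmp.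
    apply: autocorrelation_cvg0 pM _ => //.
    rewrite -[X in _ --> X](mul0r r); apply: cvgMr_tmp.
    exact: cvg_harmonic.
  - by apply: integrable_realZl; exact: integrable_2oneDsqr.
  - have h0 x : 0 <= 2 / (1 + x ^+ 2) :> R by rewrite divr_ge0// addr_ge0// sqr_ge0.
    move=> n r; rewrite normrM (ger0_norm (h0 _)) ler_wpM2r//.
    exact: normr_autocorrelation_le.
  rewrite RintegralZl//; last exact: integrable_2oneDsqr.
  rewrite {2}/Rintegral integral_2oneDsqr/= mulrC.
  rewrite /autocorrelation.
  under [in X in _ --> X -> _]eq_Rintegral do rewrite addr0 -expr2.
  by [].
exact: (cvg_unique _ cvg1 cvg2).
Qed.

End plancherel.

Section complex_plancherel.
Context {R : realType}.
Notation mu := (@lebesgue_measure R).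
Implicit Types (p q : R -> R).

(** The squared modulus of the Fourier transform of [p + i q]. *)
Definition complex_spectrum a p q b : R :=
  (fourier_cos a p b - fourier_sin a q b) ^+ 2 +
  (fourier_sin a p b + fourier_cos a q b) ^+ 2.

Lemma fourier_cosN a p b : fourier_cos a p (- b) = fourier_cos a p b.
Proof.
by rewrite /fourier_cos; apply: eq_Rintegral => t _; rewrite mulNr cosN.
Qed.

Lemma fourier_sinN a p b : mu.-integrable setT (EFin \o p) ->
  fourier_sin a p (- b) = - fourier_sin a p b.
Proof.
move=> ip; have isn := integrable_fourier_sin a b ip.
transitivity (-1 * fourier_sin a p b); last by rewrite mulN1r.
rewrite /fourier_sin -RintegralZl//.
by apply: eq_Rintegral => t _; rewrite mulNr sinN mulN1r mulrN.
Qed.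

(** The cross terms between [p] and [q] are odd functions of the frequency. *)
Lemma complex_spectrum_sym a p q b : mu.-integrable setT (EFin \o p) ->
  mu.-integrable setT (EFin \o q) ->
  complex_spectrum a p q b + complex_spectrum a p q (- b) =
  2 * (spectrum a p b + spectrum a q b).
Proof.
move=> ip iq; rewrite /complex_spectrum /spectrum.
rewrite (fourier_cosN a p) (fourier_cosN a q) (fourier_sinN a b ip) (fourier_sinN a b iq).
by ring.
Qed.

Lemma measurable_complex_spectrum a p q : measurable_fun setT p ->
  measurable_fun setT q -> measurable_fun setT (complex_spectrum a p q).
Proof.
have mc (r : R -> R) : measurable_fun setT r -> measurable_fun setT (fourier_cos a r).
  move=> mr; apply: (@measurable_fun_Rintegral _ _ _ _ _ mu
    (fun z : measurableTypeR R * measurableTypeR R => r z.2 * cos (z.1 * (z.2 - a)))).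
  by mfun.
have ms (r : R -> R) : measurable_fun setT r -> measurable_fun setT (fourier_sin a r).
  move=> mr; apply: (@measurable_fun_Rintegral _ _ _ _ _ mu
    (fun z : measurableTypeR R * measurableTypeR R => r z.2 * sin (z.1 * (z.2 - a)))).
  by mfun.
move=> mp mq; rewrite /complex_spectrum.
have h1 := mc _ mp; have h2 := mc _ mq; have h3 := ms _ mp; have h4 := ms _ mq.
by mfun.
Qed.

(** The integral is unchanged by [b |-> - b]; averaging over the two signs of
    [b] removes the cross terms and reduces to the real case. *)
Lemma complex_plancherel a p q M : mu.-integrable setT (EFin \o p) ->
  (forall t, `|p t| <= M) -> mu.-integrable setT (EFin \o q) ->
  (forall t, `|q t| <= M) ->
  (\int[mu]_b (complex_spectrum a p q b)%:E =
   (2 * pi * (\int[mu]_t (p t ^+ 2) + \int[mu]_t (q t ^+ 2)))%:E)%E.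
Proof.
move=> ip pM iq qM.
have mp := integrable_EFin_mfun ip; have mq := integrable_EFin_mfun iq.
have mS := measurable_complex_spectrum a mp mq.
have S0 b : 0 <= complex_spectrum a p q b by rewrite addr_ge0 ?sqr_ge0.
have mSN : measurable_fun setT (fun b : R => complex_spectrum a p q (- b)) by mfun.
(* Invariance of Lebesgue measure under reflection. *)
have sym : (\int[mu]_b (complex_spectrum a p q b)%:E =
    \int[mu]_b (complex_spectrum a p q (- b))%:E)%E.
  rewrite (@ge0_integral_affine _ (-1) 0)//; last by mfun.
  rewrite normrN normr1 mul1e; apply: eq_integral => b _.
  by rewrite addr0 mulN1r.
have msp := measurable_spectrum a mp; have msq := measurable_spectrum a mq.
have : (\int[mu]_b (complex_spectrum a p q b)%:E +
        \int[mu]_b (complex_spectrum a p q (- b))%:E =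
   2%:E * (\int[mu]_b (spectrum a p b)%:E + \int[mu]_b (spectrum a q b)%:E))%E.
  have sp0 := @spectrum_ge0 R a.
  rewrite (@ge0_integral_realD _ _ _ mu _ _ mS mSN S0 (fun b => S0 (- b))).
  rewrite (@ge0_integral_realD _ _ _ mu _ _ msp msq (sp0 p) (sp0 q)).
  rewrite (@ge0_integral_realZl _ _ _ mu 2 _ (measurable_funD msp msq)
    (fun b => addr_ge0 (sp0 p b) (sp0 q b)) (ler0n R 2)).
  apply: eq_integral => b _; congr EFin.
  exact: complex_spectrum_sym.
rewrite -sym (plancherel a ip pM) (plancherel a iq qM) -EFinD -EFinM -mulrDr.
case: (\int[mu]_b _)%E => [x| |] //= [] h; congr EFin; lra.
Qed.

End complex_plancherel.

(** * Injectivity of the real Laplace transform and of Gaussian convolution *)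

Section analytic_continuation.
Context {R : realType}.
Notation mu := (@lebesgue_measure R).
Variable k : R -> R.
Hypothesis ik : forall c, mu.-integrable setT (EFin \o (fun t => expR (c * `|t|) * k t)).

Let mk : measurable_fun setT k.
Proof.
have := integrable_EFin_mfun (ik 0).
by under eq_fun do rewrite mul0r expR0 mul1r.
Qed.

Lemma exprn_le_expR n (x : R) : 0 <= x -> x ^+ n <= n`!%:R * expR x.
Proof.
move=> x0; case: n => [|n].
  by rewrite expr0 fact0 mul1r -expR0 ler_expR.
rewrite -ler_pdivrMl ?ltr0n ?fact_gt0// mulrC.
by apply: le_trans (expR_ge1Dxn n x0); rewrite lerDr.
Qed.

(** One locally uniform majorant for all the derivatives in [x] of
    [expR (x * t) * k t]; the power of [t] is absorbed by one more unit in the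
    exponent. *)
Lemma moment_bound n (x c t : R) : `|x| <= c ->
  `|t ^+ n * expR (x * t) * k t| <= n`!%:R * `|expR ((c + 1) * `|t|) * k t|.
Proof.
move=> xc; rewrite !normrM mulrA ler_wpM2r// normrX !(ger0_norm (expR_ge0 _)).
rewrite mulrDl mul1r addrC expRD mulrA; apply: ler_pM => //.
- exact: exprn_le_expR.
- rewrite ler_expR (le_trans (ler_norm _))// normrM ler_wpM2r//.
Qed.

Lemma integrable_moment n (x : R) :
  mu.-integrable setT (EFin \o (fun t => t ^+ n * expR (x * t) * k t)).
Proof.
apply: (@integrable_le _ _ (fun t => n`!%:R * `|expR ((`|x| + 1) * `|t|) * k t|)).
- by mfun.
- by apply: integrable_realZl; apply: integrable_norm; exact: ik.
- by move=> t; exact: moment_bound.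
Qed.

Hypothesis laplace0 : forall x, \int[mu]_t (expR (x * t) * k t) = 0.

(** The derivative in [x] of the integral at rank [n] is the integral at rank
    [n.+1], and it is the derivative of the zero function. *)
Lemma moment_eq0 n x : \int[mu]_t (t ^+ n * expR (x * t) * k t) = 0.
Proof.
elim: n x => [|n IHn] x.
  by under eq_Rintegral do rewrite expr0 mul1r; exact: laplace0.
pose f (x t : R) := t ^+ n * expR (x * t) * k t.
have df (y t : R) : is_derive y (1:R) (f ^~ t) (t ^+ n.+1 * expR (y * t) * k t).
  rewrite (_ : f ^~ t = fun y => t ^+ n * k t * expR (t * y)); last first.
    by apply/funext => y'; rewrite /f (mulrC t); ring.
  apply: is_derive_eq (is_derive_funZ _ (is_derive_expR_lin t y)) _.
  by rewrite exprS (mulrC t y); ring.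
have d1f (y t : R) : partial1of2 f y t = t ^+ n.+1 * expR (y * t) * k t.
  rewrite partial1of2E; apply: derive_val; exact: df.
(* On the unit interval around x, the bound of moment_bound with c = |x| + 1. *)
pose G (t : R) := n.+1`!%:R * `|expR ((`|x| + 1 + 1) * `|t|) * k t|.
have := @differentiation_under_integral R _ _ mu f setT measurableT x (x - 1) (x + 1).
have Ix : `]x - 1, x + 1[%classic x by rewrite /= in_itv/=; apply/andP; split; lra.
move=> /(_ Ix).
have int_f y : `]x - 1, x + 1[%classic y -> mu.-integrable setT (EFin \o f y).
  by move=> _; exact: integrable_moment.
move=> /(_ int_f).
have der y t : `]x - 1, x + 1[%classic y -> [set: R] t -> derivable (f ^~ t) y 1.
  by move=> _ _; apply: ex_derive; exact: df.
move=> /(_ der G).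
have G0 t : 0 <= G t by rewrite mulr_ge0.
move=> /(_ G0).
have iG : mu.-integrable setT (EFin \o G).
  by apply: integrable_realZl; apply: integrable_norm; exact: ik.
move=> /(_ iG).
have GB y t : `]x - 1, x + 1[%classic y -> [set: R] t -> `|partial1of2 f y t| <= G t.
  rewrite /= in_itv/= => /andP[y1 y2] _; rewrite d1f; apply: moment_bound.
  have -> : y = x + (y - x) by ring.
  rewrite (le_trans (ler_normD _ _))// lerD2l ler_norml.
  by apply/andP; split; lra.
move=> /(_ GB).
have -> : (fun y => \int[mu]_t f y t) = cst 0 by apply/funext => y; exact: IHn.
rewrite derive1_cst => /esym; under eq_Rintegral do rewrite d1f.
by [].
Qed.

Lemma exp_partial_sum_le (x : R) n : 0 <= x ->
  \sum_(0 <= i < n) x ^+ i / i`!%:R <= expR x.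
Proof.
move=> x0; rewrite /expR.
apply: (@nondecreasing_cvgn_le _ (series (exp_coeff x))).
  by apply: nondecreasing_series => i _ _; rewrite /exp_coeff/= divr_ge0// exprn_ge0.
exact: is_cvg_series_exp_coeff.
Qed.

(** The partial sums integrate to 0 by [moment_eq0] and are dominated by
    [expR (`|b| * `|t|) * `|k t|], because the coefficients are no larger than
    those of the exponential. *)
Lemma power_series_integral_eq0 (c : nat -> R) (s : R -> R) b :
  (forall n, `|c n| <= n`!%:R^-1) ->
  (forall u, \sum_(0 <= i < n) c i * u ^+ i @[n --> \oo] --> s u) ->
  \int[mu]_t (k t * s (b * t)) = 0.
Proof.
move=> c1 cs.
have [||||_ _] := @real_dominated_convergence R
  (fun n t => k t * \sum_(0 <= i < n) c i * (b * t) ^+ i)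
  (fun t => k t * s (b * t)) (fun t => `|expR (`|b| * `|t|) * k t|).
- move=> n; apply: measurable_funM => //; apply: measurable_sum => i.
  by mfun.
- by move=> t; apply: cvgMl_tmp; exact: cs.
- by apply: integrable_norm; exact: ik.
- move=> n t; rewrite mulrC !normrM ler_wpM2r// (ger0_norm (expR_ge0 _)).
  rewrite -normrM; apply: le_trans (exp_partial_sum_le n (normr_ge0 _)).
  rewrite (le_trans (ler_norm_sum _ _ _))//; apply: ler_sum => i _.
  by rewrite normrM normrX mulrC ler_wpM2l// exprn_ge0.
have -> : (fun n => \int[mu]_t (k t * \sum_(0 <= i < n) c i * (b * t) ^+ i)) = cst 0.
  apply/funext => n /=.
  suff [] : mu.-integrable setT
      (EFin \o (fun t => k t * \sum_(0 <= i < n) c i * (b * t) ^+ i)) /\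
      \int[mu]_t (k t * \sum_(0 <= i < n) c i * (b * t) ^+ i) = 0 by [].
  elim: n => [|n [IHi IHn]].
    rewrite (_ : (fun t => _) = cst 0); last first.
      by apply/funext => t; rewrite big_geq// mulr0.
    by split; [exact: integrable0|rewrite Rintegral_cst// mul0r].
  have E t : k t * \sum_(0 <= i < n.+1) c i * (b * t) ^+ i =
     k t * (\sum_(0 <= i < n) c i * (b * t) ^+ i) +
     c n * b ^+ n * (t ^+ n * expR (0 * t) * k t).
    by rewrite big_nat_recr//= mul0r expR0 exprMn; ring.
  have im := integrable_moment n 0.
  under [fun t => k t * _]eq_fun do rewrite E.
  split; first by apply: integrable_realD => //; exact: integrable_realZl.
  rewrite RintegralD//; last exact: integrable_realZl.
  by rewrite IHn add0r RintegralZl// moment_eq0 mulr0.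
by move=> /cvg_lim <- //; rewrite lim_cst.
Qed.

Lemma fourier_cos_eq0 b : fourier_cos 0 k b = 0.
Proof.
rewrite /fourier_cos; under eq_Rintegral do rewrite subr0.
apply: (power_series_integral_eq0 (c := fun n => (~~ odd n)%:R * (-1) ^+ n./2 / n`!%:R)).
- move=> n; rewrite !normrM normrX normrN1 expr1n mulr1 normfV !normr_nat.
  by rewrite ler_piMl// lern1 leq_b1.
- move=> u; have := @is_cvg_series_cos_coeff R u.
  by rewrite cos.unlock cos_coeffE.
Qed.

Lemma fourier_sin_eq0 b : fourier_sin 0 k b = 0.
Proof.
rewrite /fourier_sin; under eq_Rintegral do rewrite subr0.
apply: (power_series_integral_eq0 (c := fun n => (odd n)%:R * (-1) ^+ n.-1./2 / n`!%:R)).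
- move=> n; rewrite !normrM normrX normrN1 expr1n mulr1 normfV !normr_nat.
  by rewrite ler_piMl// lern1 leq_b1.
- move=> u; have := @is_cvg_series_sin_coeff R u.
  by rewrite sin.unlock sin_coeffE.
Qed.

Lemma laplace_injective M : (forall t, `|k t| <= M) ->
  {ae mu, forall t, k t = 0}.
Proof.
move=> kM.
have ik0 : mu.-integrable setT (EFin \o k).
  have := ik 0; apply: eq_integrable => // t _ /=.
  by rewrite mul0r expR0 mul1r.
have := plancherel 0 ik0 kM.
under eq_integral do rewrite /spectrum fourier_cos_eq0 fourier_sin_eq0 expr0n /= addr0.
rewrite integral0 => -[/esym/eqP]; rewrite mulf_eq0 => /orP[|/eqP].
  by rewrite mulf_eq0 pnatr_eq0/= gt_eqF// pi_gt0.
move=> k20.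
have : (\int[mu]_t `|(k t ^+ 2)%:E| = 0)%E.
  under eq_integral do rewrite gee0_abs ?lee_fin ?sqr_ge0//.
  rewrite -[LHS]fineK; first by rewrite -[fine _]/(\int[mu]_t (k t ^+ 2)) k20.
  apply: integrable_fin_num => //.
  apply: (@integrable_le _ (fun t => k t ^+ 2) (fun t => M * `|k t|)); first by mfun.
    by apply: integrable_realZl; exact: integrable_norm.
  by move=> t; rewrite normrX expr2 ler_wpM2r.
move=> /(ae_eq_integral_abs _ measurableT) h.
have : ae_eq mu setT (fun t => (k t ^+ 2)%:E) (cst 0%E).
  by apply: h; mfun.
apply: filterS => t /(_ I)[/eqP]; rewrite sqrf_eq0 => /eqP.
by [].
Qed.

End analytic_continuation.

Section gaussian.
Context {R : realType}.
Notation mu := (@lebesgue_measure R).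

Lemma integral_gaussian (A m : R) : 0 < A ->
  (\int[mu]_t (expR (- (A * (t - m) ^+ 2)))%:E = (Num.sqrt pi / Num.sqrt A)%:E)%E.
Proof.
move=> A0; have sA : 0 < Num.sqrt A by rewrite sqrtr_gt0.
have mg : measurable_fun setT (fun t : R => expR (- (A * (t - m) ^+ 2))) by mfun.
have : (\int[mu]_x (gauss_fun x)%:E = (Num.sqrt A)%:E *
     \int[mu]_t (expR (- (A * (t - m) ^+ 2)))%:E)%E.
  rewrite (@ge0_integral_affine _ (Num.sqrt A) (- (Num.sqrt A * m)))//; last 3 first.
  - by rewrite gt_eqF.
  - by apply/measurable_EFinP; exact: measurable_gauss_fun.
  - by move=> x; rewrite lee_fin gauss_fun_ge0.
  rewrite gtr0_norm//; congr (_ * _)%E; apply: eq_integral => t _; congr EFin.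
  rewrite /gauss_fun -mulrBr exprMn sqr_sqrtr// ltW//.
rewrite integralT_gauss => /(congr1 (fun x => ((Num.sqrt A)^-1)%:E * x)%E).
rewrite muleA -!EFinM mulVf ?gt_eqF// mul1e => <-.
by rewrite mulrC.
Qed.

Lemma integrable_gaussian (A m : R) : 0 < A ->
  mu.-integrable setT (EFin \o (fun t => expR (- (A * (t - m) ^+ 2)))).
Proof.
move=> A0; apply/integrableP; split.
  by apply/measurable_EFinP; mfun.
under eq_integral do rewrite /= ger0_norm ?expR_ge0//.
by rewrite integral_gaussian// ltry.
Qed.

Lemma integrable_gaussian_mul (a M : R) (h : R -> R) : measurable_fun setT h ->
  (forall t, `|h t| <= M) ->
  mu.-integrable setT (EFin \o (fun t => expR (- (a - t) ^+ 2 / 2) * h t)).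
Proof.
move=> mh hM.
apply: (@integrable_le _ _ (fun t => expR (- (2^-1 * (t - a) ^+ 2)) * M)).
- by mfun.
- by apply: integrable_realZr; apply: integrable_gaussian; rewrite invr_gt0.
- move=> t; rewrite normrM (ger0_norm (expR_ge0 _)).
  rewrite (_ : - (a - t) ^+ 2 / 2 = - (2^-1 * (t - a) ^+ 2)); last by field.
  by rewrite ler_wpM2l ?expR_ge0.
Qed.

(** Completing the square turns the hypothesis at [x] into the vanishing at
    [x] of the Laplace transform of [expR (- t ^+ 2 / 2) * h t]. *)
Lemma gaussian_convolution_injective (M : R) (h : R -> R) :
  measurable_fun setT h -> (forall t, `|h t| <= M) ->
  (forall x, \int[mu]_t (expR (- (x - t) ^+ 2 / 2) * h t) = 0) ->
  {ae mu, forall t, h t = 0}.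
Proof.
move=> mh hM h0.
(* The instance at x = 0 of the integrand of the hypothesis. *)
pose k t := expR (- (0 - t) ^+ 2 / 2) * h t.
have kM t : `|k t| <= M.
  rewrite normrM (ger0_norm (expR_ge0 _)) (le_trans _ (hM t))// ler_piMl//.
  by rewrite -expR0 ler_expR mulNr oppr_le0 divr_ge0// sqr_ge0.
have ik c : mu.-integrable setT (EFin \o (fun t => expR (c * `|t|) * k t)).
  apply: (@integrable_le _ _
    (fun t => expR (- (4^-1 * (t - 0) ^+ 2)) * (expR (c ^+ 2) * M))).
  - by rewrite /k; mfun.
  - by apply: integrable_realZr; apply: integrable_gaussian; rewrite invr_gt0.
  - move=> t; rewrite /k !normrM !(ger0_norm (expR_ge0 _)) !mulrA -!expRD.
    rewrite ler_pM ?expR_ge0// ler_expR subr0 sub0r sqrrN.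
    have tt : `|t| ^+ 2 = t ^+ 2 by rewrite real_normK// num_real.
    by have := sqr_ge0 (`|t| / 2 - c); rewrite -tt;
      rewrite (_ : 4^-1 * t * t = 4^-1 * `|t| ^+ 2); [lra|rewrite tt; ring].
have k0 := @laplace_injective R k ik _ M kM.
have : {ae mu, forall t, k t = 0}.
  apply: k0 => x.
  have -> : (fun t => expR (x * t) * k t) =
     (fun t => expR (x ^+ 2 / 2) * (expR (- (x - t) ^+ 2 / 2) * h t)).
    apply/funext => t; rewrite /k !mulrA -!expRD; congr (expR _ * _); by field.
  by rewrite RintegralZl// ?h0 ?mulr0//; exact: integrable_gaussian_mul.
apply: (@filterS _ _ (ae_filter_ringOfSetsType mu)) => t /eqP.
rewrite mulf_eq0 => /orP[|/eqP//].
by rewrite gt_eqF// expR_gt0.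
Qed.

End gaussian.

(** * The energy of the Gaussian-windowed Fourier transform *)

Section gabor.
Context {R : realType}.
Notation mu := (@lebesgue_measure R).

(** The constant of the Gaussian is left out of the window; it reappears as
    [(Num.sqrt (2 * pi))^-1 ^+ 2] in [integral_windowed_energy]. *)
Definition windowed (a : R) (h : R -> R) (t : R) : R := expR (- (a - t) ^+ 2 / 2) * h t.

Lemma normr_windowed_le a M h t : (forall t, `|h t| <= M) -> `|windowed a h t| <= M.
Proof.
move=> hM.
rewrite normrM (ger0_norm (expR_ge0 _)) (le_trans _ (hM t))// ler_piMl//.
by rewrite -expR0 ler_expR mulNr oppr_le0 divr_ge0// sqr_ge0.
Qed.

Definition windowed_spectrum (f1 f2 : R -> R) (a b : R) : R :=
  complex_spectrum a (windowed a f1) (windowed a f2) b.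

Notation RR := (measurableTypeR R * measurableTypeR R)%type.

Lemma measurable_windowed_spectrum (f1 f2 : R -> R) x y :
  measurable_fun setT f1 -> measurable_fun setT f2 ->
  measurable_fun setT (fun z : RR =>
    windowed_spectrum f1 f2 (x + z.1) (y - z.2)).
Proof.
move=> m1 m2.
have m11 : measurable_fun setT (fun w : RR * measurableTypeR R => w.1.1).
  exact: (measurableT_comp measurable_fst measurable_fst).
have m12 : measurable_fun setT (fun w : RR * measurableTypeR R => w.1.2).
  exact: (measurableT_comp measurable_snd measurable_fst).
have mc (h : R -> R) : measurable_fun setT h -> measurable_fun setT (fun z : RR =>
    fourier_cos (x + z.1) (windowed (x + z.1) h) (y - z.2)).
  move=> mh; apply: (@measurable_fun_Rintegral _ _ _ _ _ mu
    (fun w : RR * measurableTypeR R => expR (- (x + w.1.1 - w.2) ^+ 2 / 2) * h w.2 *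
       cos ((y - w.1.2) * (w.2 - (x + w.1.1))))).
  by mfun.
have ms (h : R -> R) : measurable_fun setT h -> measurable_fun setT (fun z : RR =>
    fourier_sin (x + z.1) (windowed (x + z.1) h) (y - z.2)).
  move=> mh; apply: (@measurable_fun_Rintegral _ _ _ _ _ mu
    (fun w : RR * measurableTypeR R => expR (- (x + w.1.1 - w.2) ^+ 2 / 2) * h w.2 *
       sin ((y - w.1.2) * (w.2 - (x + w.1.1))))).
  by mfun.
have c1 := mc _ m1; have c2 := mc _ m2; have s1 := ms _ m1; have s2 := ms _ m2.
by rewrite /windowed_spectrum /complex_spectrum; mfun.
Qed.

(** The inner integral over the second coordinate is Plancherel's formula for
    the function windowed at [x + u].  Then Tonelli's theorem brings the
    integral over [u] inside, where
    (x - u)^2 + (x + u - t)^2 = 2 (u - t / 2)^2 + (2 x - t)^2 / 2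
    makes it Gaussian. *)
Lemma integral_windowed_energy (f1 f2 : R -> R) M x y :
  measurable_fun setT f1 -> measurable_fun setT f2 ->
  (forall t, `|f1 t| <= M) -> (forall t, `|f2 t| <= M) ->
  (\int[dA]_z ((Num.sqrt (2 * pi))^-1 ^+ 2 * expR (- (x - z.1) ^+ 2) *
     windowed_spectrum f1 f2 (x + z.1) (y - z.2))%:E =
   (\int[mu]_t ((Num.sqrt (2 * pi))^-1 * expR (- (2 * x - t) ^+ 2 / 2) *
      (f1 t ^+ 2 + f2 t ^+ 2)))%:E)%E.
Proof.
move=> m1 m2 f1M f2M.
have pi0 : 0 < (pi : R) by exact: pi_gt0.
set c := (Num.sqrt (2 * pi))^-1.
have c2 : c ^+ 2 = (2 * pi)^-1 by rewrite exprVn sqr_sqrtr// mulr_ge0// ltW.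
have mS := @measurable_windowed_spectrum f1 f2 x y m1 m2.
have S0 a b : 0 <= windowed_spectrum f1 f2 a b by rewrite addr_ge0 ?sqr_ge0.
have ip a (h : R -> R) : measurable_fun setT h -> (forall t, `|h t| <= M) ->
    mu.-integrable setT (EFin \o windowed a h).
  by move=> mh hM; exact: integrable_gaussian_mul hM.
have cS0 a b u : 0 <= c ^+ 2 * expR u * windowed_spectrum f1 f2 a b.
  exact: (mulr_ge0 (mulr_ge0 (sqr_ge0 _) (expR_ge0 _)) (S0 _ _)).
rewrite ge0_integral_mscale//=; last 2 first.
- by apply: measurable_fun_EFin; mfun.
- by move=> z _; rewrite lee_fin cS0.
rewrite fubini_tonelli1//=; last 2 first.
- by apply: measurable_fun_EFin; mfun.
- by move=> z; rewrite lee_fin cS0.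
pose F t := f1 t ^+ 2 + f2 t ^+ 2.
have F0 t : 0 <= F t by rewrite addr_ge0 ?sqr_ge0.
have mF : measurable_fun setT F by rewrite /F; mfun.
have FM t : `|F t| <= M ^+ 2 + M ^+ 2.
  rewrite (le_trans (ler_normD _ _))// !normrX lerD//.
    by rewrite !expr2 ler_pM.
  by rewrite !expr2 ler_pM.
have iF (A a : R) : 0 < A ->
    mu.-integrable setT (EFin \o (fun t => expR (- (A * (t - a) ^+ 2)) * F t)).
  move=> A0.
  apply: (@integrable_le _ _ (fun t => expR (- (A * (t - a) ^+ 2)) * (M ^+ 2 + M ^+ 2))).
  - by mfun.
  - by apply: integrable_realZr; exact: integrable_gaussian.
  - by move=> t; rewrite normrM (ger0_norm (expR_ge0 _)) ler_wpM2l ?expR_ge0.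
have fineE (g : R -> R) : mu.-integrable setT (EFin \o g) ->
    (\int[mu]_t (g t)%:E = (\int[mu]_t g t)%:E)%E.
  by move=> ig; rewrite -[LHS]fineK//; exact: integrable_fin_num.
have sq_int a (h : R -> R) : measurable_fun setT h -> (forall t, `|h t| <= M) ->
    mu.-integrable setT (EFin \o (fun t => windowed a h t ^+ 2)).
  move=> mh hM.
  apply: (@integrable_le _ _ (fun t => expR (- (1 * (t - a) ^+ 2)) * M ^+ 2)).
  - by rewrite /windowed; mfun.
  - by apply: integrable_realZr; exact: integrable_gaussian.
  - move=> t; rewrite normrX /windowed normrM exprMn (ger0_norm (expR_ge0 _)).
    rewrite -expRM_natl; apply: ler_pM; [exact: expR_ge0|by rewrite exprn_ge0| |].
      by rewrite ler_expR; lra.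
    by rewrite !expr2 ler_pM.
have inner u : (\int[mu]_v (c ^+ 2 * expR (- (x - u) ^+ 2) *
     windowed_spectrum f1 f2 (x + u) (y - v))%:E =
   \int[mu]_t (expR (- (x - u) ^+ 2 - (x + u - t) ^+ 2) * F t)%:E)%E.
  have mSu : measurable_fun setT (windowed_spectrum f1 f2 (x + u)).
    by apply: measurable_complex_spectrum; rewrite /windowed; mfun.
  have mSu' : measurable_fun setT (fun v : R =>
      windowed_spectrum f1 f2 (x + u) (y - v)).
    by mfun.
  have k0 : 0 <= c ^+ 2 * expR (- (x - u) ^+ 2) by rewrite mulr_ge0 ?expR_ge0 ?sqr_ge0.
  rewrite -(@ge0_integral_realZl _ _ _ mu _ _ mSu' (fun v => S0 _ _) k0).
  have -> : (\int[mu]_v (windowed_spectrum f1 f2 (x + u) (y - v))%:E =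
     \int[mu]_v (windowed_spectrum f1 f2 (x + u) v)%:E)%E.
    rewrite [RHS](@ge0_integral_affine _ (-1) y).
    - rewrite normrN normr1 mul1e; apply: eq_integral => v _.
      by rewrite mulN1r [- v + y]addrC.
    - by rewrite oppr_eq0 oner_eq0.
    - exact: measurable_fun_EFin.
    - by move=> v; rewrite lee_fin S0.
  rewrite (complex_plancherel (x + u)
    (ip _ _ m1 f1M) (fun t => normr_windowed_le (x + u) t f1M)
    (ip _ _ m2 f2M) (fun t => normr_windowed_le (x + u) t f2M)) -EFinM.
  rewrite -RintegralD; [|exact: measurableT|exact: sq_int|exact: sq_int].
  rewrite c2 mulrACA (_ : (2 * pi)^-1 * (2 * pi) = 1) ?mul1r; last first.
    by rewrite mulVf// gt_eqF// mulr_gt0.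
  have E t : windowed (x + u) f1 t ^+ 2 + windowed (x + u) f2 t ^+ 2 =
      expR (- (1 * (t - (x + u)) ^+ 2)) * F t.
    rewrite /windowed !exprMn -mulrDr -expRM_natl; congr (expR _ * _); by field.
  have E' t : expR (- (x - u) ^+ 2 - (x + u - t) ^+ 2) * F t =
     expR (- (x - u) ^+ 2) * (expR (- (1 * (t - (x + u)) ^+ 2)) * F t).
    rewrite mulrA -expRD; congr (expR _ * _); by ring.
  under eq_Rintegral do rewrite E.
  under [in RHS]eq_integral do rewrite E'.
  rewrite fineE; last by apply: integrable_realZl; exact: iF.
  by congr EFin; rewrite RintegralZl//; exact: iF.
rewrite /fubini_F; under eq_integral do rewrite inner.
pose E (z : RR) := expR (- (x - z.1) ^+ 2 - (x + z.1 - z.2) ^+ 2) * F z.2.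
have mE : measurable_fun setT E.
  by rewrite /E; mfun.
rewrite (fubini_tonelli (EFin \o E))//=; last 2 first.
- exact: measurable_fun_EFin.
- by move=> z; rewrite lee_fin mulr_ge0 ?expR_ge0.
have outer t : (\int[mu]_u (expR (- (x - u) ^+ 2 - (x + u - t) ^+ 2) * F t)%:E =
   (Num.sqrt pi / Num.sqrt 2 * (expR (- (2 * x - t) ^+ 2 / 2) * F t))%:E)%E.
  have completed_square u :
     expR (- (x - u) ^+ 2 - (x + u - t) ^+ 2) * F t =
     (expR (- (2 * x - t) ^+ 2 / 2) * F t) * expR (- (2 * (u - t / 2) ^+ 2)).
    rewrite mulrAC -expRD; congr (expR _ * _); by field.
  under eq_integral do rewrite completed_square.
  have mgt : measurable_fun setT (fun u : R => expR (- (2 * (u - t / 2) ^+ 2))) by mfun.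
  rewrite -(@ge0_integral_realZl _ _ _ mu _ _ mgt (fun u => expR_ge0 _)); last first.
    by rewrite mulr_ge0 ?expR_ge0.
  by rewrite integral_gaussian// -EFinM mulrC.
under eq_integral do rewrite outer.
have mG : measurable_fun setT (fun t : R =>
    Num.sqrt pi / Num.sqrt 2 * (expR (- (2 * x - t) ^+ 2 / 2) * F t)).
  by mfun.
have G0 t : 0 <= Num.sqrt pi / Num.sqrt 2 * (expR (- (2 * x - t) ^+ 2 / 2) * F t).
  by rewrite !mulr_ge0 ?expR_ge0 ?invr_ge0 ?sqrtr_ge0.
rewrite (@ge0_integral_realZl _ _ _ mu _ _ mG G0 (invpi_ge0 (R := R))).
rewrite -fineE; last first.
  have h2 : 0 < 2^-1 :> R by rewrite invr_gt0.
  have := integrable_realZl c (iF _ (2 * x) h2).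
  apply: eq_integrable => // t _; congr EFin; rewrite mulrA; congr (_ * expR _ * _).
  by field.
apply: eq_integral => t _; congr EFin; rewrite -/(F t) !mulrA; congr (_ * _ * _).
rewrite /c sqrtrM//; set s := Num.sqrt pi; set q := Num.sqrt 2.
have s0 : s != 0 by rewrite gt_eqF// sqrtr_gt0.
have q0 : q != 0 by rewrite gt_eqF// sqrtr_gt0.
have -> : pi = s ^+ 2 by rewrite sqr_sqrtr// ltW.
by field; rewrite s0 q0.
Qed.

End gabor.

(** * Reduction of the mass-one equation to the real line *)

Section complex_arith.
Context {R : realType}.
Notation mu := (@lebesgue_measure R).
Local Notation C := R[i]%C.
Implicit Types z w : C.

Lemma complex_eta z : z = (complex.Re z +i* complex.Im z)%C.
Proof. by case: z. Qed.

Lemma complex_div2 (x y : R) : ((x +i* y) / 2 = (x / 2) +i* (y / 2) :> C)%C.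
Proof.
apply: (canLR (mulfK _)); first by rewrite pnatr_eq0.
rewrite mulr_natr mulr2n; apply/eqP; rewrite eq_complex /=.
by apply/andP; split; apply/eqP; field.
Qed.

Lemma Re_div_real (a r : R) : complex.Re (a%:C / r%:C)%C = a / r.
Proof. by rewrite -fmorphV -rmorphM. Qed.

(** With [z = a - t + i b], the real part of - z^2 / 2 is
    (b^2 - (a - t)^2) / 2 and its imaginary part is b (t - a). *)
Lemma gammaE (a b t : R) :
  gamma ((a +i* b) - t%:C)%C =
  ((Num.sqrt (2 * pi))^-1 * expR (b ^+ 2 / 2) *
     (expR (- (a - t) ^+ 2 / 2) * cos (b * (t - a))) +i*
   ((Num.sqrt (2 * pi))^-1 * expR (b ^+ 2 / 2) *
     (expR (- (a - t) ^+ 2 / 2) * sin (b * (t - a)))))%C.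
Proof.
have -> : ((a +i* b) - t%:C = (a - t) +i* b :> C)%C.
  by apply/eqP; rewrite eq_complex /= subr0 !eqxx.
have -> : gamma ((a - t) +i* b)%C =
    ((Num.sqrt (2 * pi))^-1)%:C%C *
    cexp ((- (a - t) ^+ 2 / 2 + b ^+ 2 / 2) +i* (b * (t - a)))%C.
  rewrite /gamma; congr (_ * cexp _).
  have -> : (- ((a - t) +i* b) ^+ 2 =
      (- (a - t) ^+ 2 + b ^+ 2) +i* (b * (t - a) + b * (t - a)) :> C)%C.
    apply/eqP; rewrite eq_complex /=.
    by apply/andP; split; apply/eqP; ring.
  rewrite complex_div2; apply/eqP; rewrite eq_complex /=.
  by apply/andP; split; apply/eqP; field.
rewrite /cexp /= expRD; apply/eqP; rewrite eq_complex /=.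
by apply/andP; split; apply/eqP; ring.
Qed.

Lemma normr_cexp_sqr (x y : R) : `|cexp (x +i* y)%C| ^+ 2 = (expR x ^+ 2)%:C%C.
Proof.
rewrite -add_Re2_Im2; congr (_ %:C)%C; rewrite /= !mul0r subr0 addr0.
by rewrite !exprMn -mulrDr cos2Dsin2 mulr1.
Qed.

Variable f : R -> C.
Hypothesis hf : bounded_borel f.

Let f1 t := complex.Re (f t).
Let f2 t := complex.Im (f t).

Lemma bounded_Re_Im : exists M : R,
  (forall t, `|complex.Re (f t)| <= M) /\ (forall t, `|complex.Im (f t)| <= M).
Proof.
have [_ _ [M hM]] := hf; exists M.
have h (t : R) : complex.Re (f t) ^+ 2 + complex.Im (f t) ^+ 2 <= M ^+ 2 /\ 0 <= M.
  have := hM t; rewrite normc_def lecR => h; have M0 := le_trans (sqrtr_ge0 _) h.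
  split => //; rewrite -(@ler_sqrt _ _ (M ^+ 2)) ?sqr_ge0//.
  by rewrite sqrtr_sqr ger0_norm.
split => t; have [h1 h2] := h t; rewrite -[leRHS]ger0_norm// -ler_sqr ?nnegrE//;
  rewrite !real_normK ?num_real//; have := sqr_ge0 (complex.Re (f t));
  have := sqr_ge0 (complex.Im (f t)); lra.
Qed.

Lemma measurable_Re : measurable_fun setT (fun t => complex.Re (f t)).
Proof. by have [] := hf. Qed.

Lemma measurable_Im : measurable_fun setT (fun t => complex.Im (f t)).
Proof. by have [] := hf. Qed.

Let c : R := (Num.sqrt (2 * pi))^-1.

Lemma Re_gamma_conv a b : complex.Re (gamma_conv f (a +i* b)%C) =
  c * expR (b ^+ 2 / 2) *
   (fourier_cos a (windowed a f1) b - fourier_sin a (windowed a f2) b).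
Proof.
have [M [M1 M2]] := bounded_Re_Im.
have i1 : mu.-integrable setT (EFin \o windowed a f1).
  exact: integrable_gaussian_mul measurable_Re M1.
have i2 : mu.-integrable setT (EFin \o windowed a f2).
  exact: integrable_gaussian_mul measurable_Im M2.
have ic := integrable_fourier_cos a b i1; have isn := integrable_fourier_sin a b i2.
rewrite /fourier_cos /fourier_sin -RintegralB//.
rewrite -RintegralZl//; last exact: integrable_realB.
apply: eq_Rintegral => t _; rewrite gammaE /windowed /f1 /f2 -/c.
by case: (f t) => x y /=; ring.
Qed.

Lemma Im_gamma_conv a b : complex.Im (gamma_conv f (a +i* b)%C) =
  c * expR (b ^+ 2 / 2) *
   (fourier_sin a (windowed a f1) b + fourier_cos a (windowed a f2) b).
Proof.
have [M [M1 M2]] := bounded_Re_Im.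
have i1 : mu.-integrable setT (EFin \o windowed a f1).
  exact: integrable_gaussian_mul measurable_Re M1.
have i2 : mu.-integrable setT (EFin \o windowed a f2).
  exact: integrable_gaussian_mul measurable_Im M2.
have ic := integrable_fourier_cos a b i2; have isn := integrable_fourier_sin a b i1.
rewrite /fourier_cos /fourier_sin -RintegralD//.
rewrite -RintegralZl//; last exact: integrable_realD.
apply: eq_Rintegral => t _; rewrite gammaE /windowed /f1 /f2 -/c.
by case: (f t) => x y /=; ring.
Qed.

Lemma ginibre_diag z : ginibre z z = 1.
Proof.
rewrite /ginibre (_ : _ - _ = 0).
  rewrite /cexp /= expR0 cos0 sin0; apply/eqP; rewrite eq_complex /=.
  by apply/andP; split; apply/eqP; ring.
by rewrite -normCK; field.
Qed.

(** The exponent of the Ginibre kernel has real part - |z - w|^2 / 2. *)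
Lemma normr_ginibre_sqr (x y u v : R) :
  `|ginibre (x +i* y)%C (u +i* v)%C| ^+ 2 =
  (expR (- (x - u) ^+ 2) * expR (- (y - v) ^+ 2))%:C%C.
Proof.
rewrite /ginibre.
have -> : `|(x +i* y)%C| ^+ 2 = (x ^+ 2 + y ^+ 2)%:C%C by rewrite -add_Re2_Im2.
have -> : `|(u +i* v)%C| ^+ 2 = (u ^+ 2 + v ^+ 2)%:C%C by rewrite -add_Re2_Im2.
have -> : ((x +i* y) * conjc (u +i* v) - (x ^+ 2 + y ^+ 2)%:C / 2 -
     (u ^+ 2 + v ^+ 2)%:C / 2 =
   (- ((x - u) ^+ 2 + (y - v) ^+ 2) / 2) +i* (y * u - x * v) :> C)%C.
  rewrite !complex_div2; apply/eqP; rewrite eq_complex /=.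
  by apply/andP; split; apply/eqP; field.
rewrite normr_cexp_sqr -expRM_natl -expRD; congr ((expR _)%:C)%C; by field.
Qed.

Lemma normr_gamma_conv_sqr a b : `|gamma_conv f (a +i* b)%C| ^+ 2 =
  (c ^+ 2 * expR (b ^+ 2) * windowed_spectrum f1 f2 a b)%:C%C.
Proof.
rewrite -add_Re2_Im2 Re_gamma_conv Im_gamma_conv; congr (_%:C)%C.
rewrite /windowed_spectrum /complex_spectrum
    (_ : expR (b ^+ 2) = expR (b ^+ 2 / 2) ^+ 2); first by ring.
by rewrite -expRM_natl; congr expR; field.
Qed.

Let Psi (z w : C) := gamma_conv f (z + conjc w).

Lemma Psi_diag (x y : R) : Psi (x +i* y)%C (x +i* y)%C = gamma_conv f (2 * x)%:C%C.
Proof.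
rewrite /Psi; congr gamma_conv; apply/eqP; rewrite eq_complex /=.
by apply/andP; split; apply/eqP; ring.
Qed.

(** The factor [expR (- (y - v) ^+ 2)] of the Ginibre kernel cancels the growth
    of [gamma_conv] along the imaginary direction. *)
Lemma berezinE (x y u v r : R) : gamma_conv f (2 * x)%:C%C = r%:C%C ->
  complex.Re (berezin (kernel_of Psi) (x +i* y)%C (u +i* v)%C) =
  r^-1 * (c ^+ 2 * expR (- (x - u) ^+ 2) *
    windowed_spectrum f1 f2 (x + u) (y - v)).
Proof.
move=> hr; rewrite /berezin /kernel_of ginibre_diag mul1r Psi_diag hr.
rewrite normrM exprMn normr_ginibre_sqr /Psi.
have -> : (x +i* y + conjc (u +i* v) = (x + u) +i* (y - v) :> C)%C.
  by apply/eqP; rewrite eq_complex /= !eqxx.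
rewrite normr_gamma_conv_sqr -rmorphM Re_div_real mulrC; congr (_ * _).
rewrite [expR (- (y - v) ^+ 2)]expRN.
by field; rewrite gt_eqF// expR_gt0.
Qed.

Definition weierstrass (h : R -> R) (x : R) :=
  \int[mu]_t (c * expR (- (x - t) ^+ 2 / 2) * h t).

Lemma gamma_conv_real x :
  gamma_conv f x%:C%C = (weierstrass f1 x +i* weierstrass f2 x)%C.
Proof.
have := Re_gamma_conv x 0; have := Im_gamma_conv x 0.
rewrite [gamma_conv f x%:C%C]complex_eta.
rewrite /= => -> ->; rewrite expr0n mul0r expR0 mulr1.
have [M [M1 M2]] := bounded_Re_Im.
have i1 : mu.-integrable setT (EFin \o windowed x f1).
  exact: integrable_gaussian_mul measurable_Re M1.
have i2 : mu.-integrable setT (EFin \o windowed x f2).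
  exact: integrable_gaussian_mul measurable_Im M2.
have c0 (h : R -> R) : fourier_cos x h 0 = \int[mu]_t h t.
  by apply: eq_Rintegral => t _; rewrite mul0r cos0 mulr1.
have s0 (h : R -> R) : fourier_sin x h 0 = 0.
  rewrite /fourier_sin; under eq_Rintegral do rewrite mul0r sin0 mulr0.
  by rewrite Rintegral_cst// mul0r.
have wE (h : R -> R) : mu.-integrable setT (EFin \o windowed x h) ->
    weierstrass h x = c * \int[mu]_t windowed x h t.
  move=> ih; rewrite -RintegralZl//; apply: eq_Rintegral => t _.
  by rewrite /windowed mulrA.
by rewrite !c0 !s0 subr0 add0r !wE.
Qed.

Lemma integral_berezin (x y r : R) : 0 < r -> gamma_conv f (2 * x)%:C%C = r%:C%C ->
  (\int[dA]_p (complex.Re (berezin (kernel_of Psi) (x +i* y)%C (to_complex p)))%:E =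
   (r^-1 * weierstrass (fun t => f1 t ^+ 2 + f2 t ^+ 2) (2 * x))%:E)%E.
Proof.
move=> r0 hr; have [M [M1 M2]] := bounded_Re_Im.
have mS := measurable_windowed_spectrum x y measurable_Re measurable_Im.
under eq_integral do rewrite /to_complex (@berezinE x y _ _ r hr).
rewrite EFinM /weierstrass.
rewrite -(integral_windowed_energy x y measurable_Re measurable_Im M1 M2).
rewrite ge0_integral_realZl//.
- by mfun.
- move=> z; apply: mulr_ge0; last by rewrite addr_ge0 ?sqr_ge0.
  by rewrite mulr_ge0 ?expR_ge0 ?sqr_ge0.
- by rewrite invr_ge0 ltW.
Qed.

(** Every real point is of the form [2 x], so the equations for all [z] exhaust
    the real line; positivity of a complex number includes the vanishing of
    its imaginary part. *)
Lemma mass_one_solutionE : mass_one_solution Psi <->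
  forall x, [/\ 0 < weierstrass f1 x, weierstrass f2 x = 0 &
     weierstrass (fun t => f1 t ^+ 2 + f2 t ^+ 2) x = weierstrass f1 x].
Proof.
split=> [[hpos hint] x|h].
  have x2 : 2 * (x / 2) = x by field.
  have [_] := hpos ((x / 2) +i* 0)%C; rewrite Psi_diag x2 gamma_conv_real.
  rewrite ltcE/= => /andP[/eqP w2 w1].
  have gE : gamma_conv f (2 * (x / 2))%:C%C = (weierstrass f1 x)%:C%C.
    by rewrite x2 gamma_conv_real w2.
  have := hint ((x / 2) +i* 0)%C; rewrite (integral_berezin 0 w1 gE) x2 => -[].
  move=> /(congr1 (fun u => weierstrass f1 x * u)); rewrite mulVKf ?gt_eqF// mulr1.
  by split.
have wE x : gamma_conv f x%:C%C = (weierstrass f1 x)%:C%C.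
  by have [_ w2 _] := h x; rewrite gamma_conv_real w2.
split=> [[x y]|[x y]].
  rewrite /kernel_of ginibre_diag mul1r; split => //.
  by rewrite Psi_diag wE ltcR; have [] := h (2 * x).
have [w1 _ w3] := h (2 * x).
by rewrite (integral_berezin y w1 (wE _)) w3 mulVf// gt_eqF.
Qed.

End complex_arith.

(** * Indicator functions and the characterization *)

Section indicator.
Context {R : realType}.
Notation mu := (@lebesgue_measure R).
Implicit Types (h : R -> R) (e : set (measurableTypeR R)).

Let c : R := (Num.sqrt (2 * pi))^-1.

Let c_gt0 : 0 < c.
Proof. by rewrite invr_gt0 sqrtr_gt0 mulr_gt0// pi_gt0. Qed.

Lemma weierstrassE h M x : measurable_fun setT h -> (forall t, `|h t| <= M) ->
  weierstrass h x = c * \int[mu]_t (expR (- (x - t) ^+ 2 / 2) * h t).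
Proof.
move=> mh hM; rewrite -RintegralZl//; last exact: integrable_gaussian_mul hM.
by apply: eq_Rintegral => t _; rewrite mulrA.
Qed.

Lemma weierstrass_ae h1 h2 x : measurable_fun setT h1 -> measurable_fun setT h2 ->
  {ae mu, forall t, h1 t = h2 t} -> weierstrass h1 x = weierstrass h2 x.
Proof.
move=> m1 m2 h12; congr fine; apply: ae_eq_integral => //.
- by mfun.
- by mfun.
- by apply: (@filterS _ _ (ae_filter_ringOfSetsType mu)) h12 => t -> _.
Qed.

Lemma ae_indic0 e : measurable e -> {ae mu, forall t, (\1_e t : R) = 0} <-> mu e = 0%E.
Proof.
move=> me; have eE : e = ~` [set t | (\1_e t : R) = 0].
  apply/seteqP; split=> t /=; rewrite indicE.
    by move=> et; rewrite mem_set// => /eqP; rewrite oner_eq0.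
  by have [/set_mem//|_] := boolP (t \in e).
by rewrite -(negligibleP mu me) [X in _ <-> mu.-negligible X]eE.
Qed.

(** The Gaussian is positive, so the integral vanishes only if the indicator
    function vanishes almost everywhere. *)
Lemma weierstrass_indic_gt0 e x : measurable e ->
  (0 < weierstrass (\1_e : R -> R) x) <-> (0 < mu e)%E.
Proof.
move=> me; have m1 : measurable_fun setT (\1_e : measurableTypeR R -> R).
  exact: measurable_indic.
have b1 t : `|\1_e t| <= 1 :> R.
  by rewrite indicE; case: (t \in e); rewrite ?normr1 ?normr0.
have W0 : 0 <= weierstrass (\1_e : R -> R) x.
  by apply: Rintegral_ge0 => t _; rewrite !mulr_ge0 ?expR_ge0 ?(ltW c_gt0).
rewrite lt0e measure_ge0 andbT lt_def W0 andbT.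
suff : (weierstrass (\1_e : R -> R) x = 0) <-> (mu e = 0%E).
  by move=> [h1 h2]; split=> /eqP h; apply/eqP; [move/h2|move/h1].
rewrite -(ae_indic0 me); split => [h|h]; last first.
  rewrite (@weierstrass_ae _ (cst 0) x m1 (measurable_cst (0 : R)) h) /weierstrass.
  by under eq_Rintegral do rewrite mulr0; rewrite Rintegral_cst// mul0r.
have ig := integrable_gaussian_mul x m1 b1.
move: h; rewrite (weierstrassE x m1 b1) => /eqP; rewrite mulf_eq0 gt_eqF//= => /eqP h.
have : (\int[mu]_t `|(expR (- (x - t) ^+ 2 / 2) * \1_e t)%:E| = 0)%E.
  under eq_integral do rewrite gee0_abs ?lee_fin ?mulr_ge0 ?expR_ge0//.
  rewrite -[LHS]fineK; last exact: integrable_fin_num.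
  by rewrite -[fine _]/(\int[mu]_t (expR (- (x - t) ^+ 2 / 2) * \1_e t)) h.
have mE : measurable_fun setT
    (fun t : R => (expR (- (x - t) ^+ 2 / 2) * \1_e t)%:E : \bar R).
  by mfun.
move=> h'; have := (ae_eq_integral_abs mu measurableT mE).1 h'.
apply: (@filterS _ _ (ae_filter_ringOfSetsType mu)) => t /(_ I)[/eqP].
by rewrite mulf_eq0 gt_eqF ?expR_gt0//= => /eqP.
Qed.

End indicator.

Theorem theorem7 (R : realType) (f : R -> R[i]%C) (hf : bounded_borel f) :
  mass_one_solution (fun z w : R[i]%C => gamma_conv f (z + conjc w)) <->
  exists e : set R,
    [/\ measurable e,
        (0 < @lebesgue_measure R e)%E
      & {ae @lebesgue_measure R, forall t, f t = (\1_e t)%:C%C}].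
Proof.
have m1 := measurable_Re hf; have m2 := measurable_Im hf.
have [M [M1 M2]] := bounded_Re_Im hf.
have c0 : (Num.sqrt (2 * pi))^-1 != 0 :> R.
  by rewrite invr_eq0 gt_eqF// sqrtr_gt0 mulr_gt0// pi_gt0.
pose sq t := complex.Re (f t) ^+ 2 + complex.Im (f t) ^+ 2.
have msq : measurable_fun setT sq by rewrite /sq; mfun.
have sqM t : `|sq t| <= M ^+ 2 + M ^+ 2.
  rewrite (le_trans (ler_normD _ _))// !normrX lerD// !expr2.
    by rewrite ler_pM.
  by rewrite ler_pM.
have w1 (e : set R) x : measurable e ->
    {ae @lebesgue_measure R, forall t, f t = (\1_e t)%:C%C} ->
    weierstrass (fun t => complex.Re (f t)) x = weierstrass (\1_e) x.
  move=> me fe; have mi : measurable_fun setT (\1_e : R -> R) by apply: measurable_indic.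
  apply: (weierstrass_ae x m1 mi).
  by apply: (@filterS _ _ (ae_filter_ringOfSetsType lebesgue_measure)) fe => t ->.
rewrite (mass_one_solutionE hf); split => [h|[e [me mue fe]] x].
  have im0 : {ae @lebesgue_measure R, forall t, complex.Im (f t) = 0}.
    apply: (gaussian_convolution_injective m2 M2) => x.
    have [_ + _] := h x; rewrite (weierstrassE x m2 M2) => /eqP.
    by rewrite mulf_eq0 (negbTE c0)/= => /eqP.
  have sqf : {ae @lebesgue_measure R, forall t, sq t - complex.Re (f t) = 0}.
    apply: (@gaussian_convolution_injective _ (M ^+ 2 + M ^+ 2 + M)).
    - by mfun.
    - by move=> t; rewrite (le_trans (ler_normB _ _))// lerD.
    - move=> x; have [_ _] := h x.
      rewrite (weierstrassE x m1 M1) (weierstrassE x msq sqM) => /(mulfI c0) E.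
      under eq_Rintegral do rewrite mulrBr.
      rewrite RintegralB//.
      + by rewrite E subrr.
      + exact: integrable_gaussian_mul sqM.
      + exact: integrable_gaussian_mul M1.
  (* Where f is 0 or 1, it is the indicator function of the level set of 1. *)
  pose e : set R := (fun t => complex.Re (f t)) @^-1` [set 1].
  have me : measurable e.
    by rewrite -[e]setTI; apply: m1 => //; exact: measurable_set1.
  have fe : {ae @lebesgue_measure R, forall t, f t = (\1_e t)%:C%C}.
    apply: (@filterS2 _ _ (ae_filter_ringOfSetsType lebesgue_measure)) im0 sqf => t i0.
    rewrite /sq i0 expr0n addr0 expr2 -[X in _ - X]mulr1 -mulrBr => /eqP.
    rewrite mulf_eq0 subr_eq0 indicE => /orP[/eqP r0|/eqP r1].
      rewrite memNset; last by rewrite /e/= r0 => /esym/eqP; rewrite oner_eq0.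
      by rewrite (complex_eta (f t)) i0 r0.
    by rewrite mem_set// (complex_eta (f t)) i0 r1.
  exists e; split => //.
  apply/(weierstrass_indic_gt0 0 me); have [+ _ _] := h 0.
  by rewrite (w1 e 0).
have {}w1 := w1 e x me fe.
split.
- by rewrite w1; apply/(weierstrass_indic_gt0 x me).
- rewrite (@weierstrass_ae _ _ (cst 0) x m2)//; last first.
    by apply: (@filterS _ _ (ae_filter_ringOfSetsType lebesgue_measure)) fe => t ->.
  rewrite /weierstrass; under eq_Rintegral do rewrite mulr0.
  by rewrite Rintegral_cst// mul0r.
- apply: weierstrass_ae => //.
  apply: (@filterS _ _ (ae_filter_ringOfSetsType lebesgue_measure)) fe => t -> /=.
  by rewrite indicE; case: (t \in e) => /=; ring.
Qed.
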